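(* Let $J\in\mathbb{C}^{q\times q}$ be a signature matrix, let $F\in\mathbb{C}^{q\times q}\langle\langle z_1,\ldots,z_N\rangle\rangle_{\rm rat}$ be a rational formal power series, and let $\alpha=(N;A,B,C,D;\mathbb{C}^\gamma=\bigoplus_{k=1}^N\mathbb{C}^{\gamma_k},\mathbb{C}^q)$ be a minimal GR-realization of $F$. Then $F$ is matrix-$J$-unitary on $\mathcal{J}_N$ if and only if the following conditions are fulfilled: (a) $D$ is $J$-unitary, i.e., $DJD^*=J$; (b) there exists an invertible Hermitian solution $H={\rm diag}(H_1,\ldots,H_N)$, with $H_k\in\mathbb{C}^{\gamma_k\times\gamma_k}$, $k=1,\ldots,N$, of the Lyapunov equation $$A^*H+HA=-C^*JC,$$ and $$B=-H^{-1}C^*JD.$$ The property (b) is equivalent to (b') there exists an invertible Hermitian matrix $H={\rm diag}(H_1,\ldots,H_N)$, with $H_k\in\mathbb{C}^{\gamma_k\times\gamma_k}$, $k=1,\ldots,N$, such that $$H^{-1}A^*+AH^{-1}=-BJB^*,$$ and $$C=-DJB^*H.$$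
   Context: Formal power series. $\mathcal{F}_N$ is the free monoid on generators $g_1,\ldots,g_N$ with empty word $\emptyset$. A formal power series (FPS) in non-commuting indeterminates $z_1,\ldots,z_N$ is $f(z)=\sum_{w\in\mathcal{F}_N}f_wz^w$, where $z^w=z_{i_1}\cdots z_{i_n}$ for $w=g_{i_1}\cdots g_{i_n}$; the indeterminates commute with coefficients and products are by convolution over factorizations of words. A scalar FPS is rational if it is obtained from non-commutative polynomials by finitely many sums, products and inversions (of FPSs with non-zero constant term); a matrix FPS is rational if all its entries are. $\mathbb{C}^{q\times q}\langle\langle z_1,\ldots,z_N\rangle\rangle_{\rm rat}$ is the space of rational FPSs with $q\times q$ coefficients. GR-nodes. A GR-node $\alpha=(N;A,B,C,D;\mathbb{C}^r=\bigoplus_{k=1}^N\mathbb{C}^{r_k},\mathbb{C}^q)$ consists of matrices $A\in\mathbb{C}^{r\times r}$, $B\in\mathbb{C}^{r\times q}$, $C\in\mathbb{C}^{q\times r}$, $D\in\mathbb{C}^{q\times q}$, with blocks $A_{ij},B_i,C_j$ along the decomposition of $\mathbb{C}^r$. Its transfer function is the rational FPS $T^{\rm nc}_\alpha(z)=D+C(I_r-\Delta(z)A)^{-1}\Delta(z)B$ with $\Delta(z)={\rm diag}(z_1I_{r_1},\ldots,z_NI_{r_N})$, i.e. the coefficient at $\emptyset$ is $D$ and at $w=g_{j_1}\cdots g_{j_n}$ it is $C_{j_1}A_{j_1j_2}\cdots A_{j_{n-1}j_n}B_{j_n}$. $\alpha$ is a GR-realization of $F$ if $T_\alpha^{\rm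 nc}=F$; it is minimal if each $r_k$ ($k=1,\ldots,N$) is the smallest possible among all GR-realizations of $F$. For minimal realizations one writes $\gamma_k$ for $r_k$ and $\gamma=\sum_k\gamma_k$. Evaluation. For $Z=(Z_1,\ldots,Z_N)\in(\mathbb{C}^{n\times n})^N$, $F(Z)$ is obtained by substituting $Z_k$ for $z_k$ in a rational expression for $F$; near $Z=0$ it equals $\sum_wF_w\otimes Z^w$, and it is a $\mathbb{C}^{q\times q}\otimes\mathbb{C}^{n\times n}$-valued rational function of the entries of the $Z_k$, defined (holomorphic) on an open dense set containing a neighbourhood of $0$. Matrix-$J$-unitarity. A signature matrix is $J$ with $J=J^*=J^{-1}$. Let $\mathbb{H}^{n\times n}$ be the set of Hermitian $n\times n$ matrices and $\mathcal{J}_N=\coprod_{n\in\mathbb{N}}(i\mathbb{H}^{n\times n})^N$. $F$ is matrix-$J$-unitary on $\mathcal{J}_N$ if for every $n\in\mathbb{N}$, $F(Z)(J\otimes I_n)F(Z)^*=J\otimes I_n$ at all $Z\in(i\mathbb{H}^{n\times n})^N$ where $F(Z)$ is defined.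
   Formalization: The equivalence of (b) and (b') is stated under condition (a); without (a) it fails, e.g. N=1, γ=1, q=2, J=I, A=−1, C=(1,1)^T, D=diag(1,2), B=(−1,−2), where (b) holds with H=1 but (b') has no solution. *)

(* Defs.v *)
From HB Require Import structures.
From mathcomp Require Import all_boot all_order all_algebra.
From mathcomp Require Import reals complex mxtens mpoly.
Set Implicit Arguments. Unset Strict Implicit. Unset Printing Implicit Defensive.
Import Order.TTheory GRing.Theory Num.Theory.
Local Open Scope ring_scope.
Local Open Scope sesquilinear_scope.

Section Defs.
Variable C : numClosedFieldType.

Definition hermitian_mx n (X : 'M[C]_n) : Prop := X ^t* = X.

Definition signature_mx q (J : 'M[C]_q) : Prop := J ^t* = J /\ J *m J = 1%:M.

Section Series.
Variable N : nat.

(* The word g_{j_1} ... g_{j_n} is the sequence [:: j_1; ...; j_n]. *)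
Definition word := seq 'I_N.

Definition fps := word -> C.
Definition mxfps q := word -> 'M[C]_q.

Definition ncpoly := seq (C * word).
Definition fps_poly (p : ncpoly) : fps := fun w => \sum_(m <- p | m.2 == w) m.1.
Definition fps_one : fps := fun w => (w == [::])%:R.
Definition fps_add (f g : fps) : fps := fun w => f w + g w.
Definition fps_mul (f g : fps) : fps :=
  fun w => \sum_(i < (size w).+1) f (take i w) * g (drop i w).

Inductive rexpr : Type :=
| RPoly of ncpoly
| RAdd of rexpr & rexpr
| RMul of rexpr & rexpr
| RInv of rexpr.

(* [represents e f]: every inversion in [e] is applied to a series with
   non-zero constant term, and [e] evaluates to [f] in the ring of series. *)
Fixpoint represents (e : rexpr) (f : fps) : Prop :=
  match e with
  | RPoly p => f =1 fps_poly p
  | RAdd e1 e2 => exists f1 f2,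
      [/\ represents e1 f1, represents e2 f2 & f =1 fps_add f1 f2]
  | RMul e1 e2 => exists f1 f2,
      [/\ represents e1 f1, represents e2 f2 & f =1 fps_mul f1 f2]
  | RInv e1 => exists f1,
      [/\ represents e1 f1, f1 [::] != 0,
          fps_mul f f1 =1 fps_one & fps_mul f1 f =1 fps_one]
  end.

Definition rational (f : fps) : Prop := exists e, represents e f.

Definition mx_entry q (F : mxfps q) (a b : 'I_q) : fps := fun w => F w a b.

Definition mx_rational q (F : mxfps q) : Prop :=
  forall a b, rational (mx_entry F a b).

Record grnode (q : nat) := GRNode {
  gr_dim : 'I_N -> nat;
  gr_A : 'M[C]_(\sum_k gr_dim k);
  gr_B : 'M[C]_(\sum_k gr_dim k, q);
  gr_C : 'M[C]_(q, \sum_k gr_dim k);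
  gr_D : 'M[C]_q }.

Section Node.
Variables (q : nat) (al : grnode q).

Definition blockA (i j : 'I_N) : 'M[C]_(gr_dim al i, gr_dim al j) :=
  submxblock (gr_A al) i j.
Definition blockB (i : 'I_N) : 'M[C]_(gr_dim al i, q) := submxcol (gr_B al) i.
Definition blockC (j : 'I_N) : 'M[C]_(q, gr_dim al j) := submxrow (gr_C al) j.

(* A_{j j_2} A_{j_2 j_3} ... A_{j_{n-1} j_n} B_{j_n} for [w = j_2 ... j_n] *)
Fixpoint pathAB (j : 'I_N) (w : word) : 'M[C]_(gr_dim al j, q) :=
  if w is k :: w' then blockA j k *m pathAB k w' else blockB j.

Definition transfer : mxfps q :=
  fun w => if w is j :: w' then blockC j *m pathAB j w' else gr_D al.

End Node.

Definition gr_realization q (al : grnode q) (F : mxfps q) : Prop :=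
  transfer al =1 F.

Definition minimal_gr_realization q (al : grnode q) (F : mxfps q) : Prop :=
  gr_realization al F /\
  forall be : grnode q, gr_realization be F ->
    forall k, (gr_dim al k <= gr_dim be k)%N.

Section Evaluation.
Variable n : nat.
Implicit Type Z : 'I_N -> 'M[C]_n.

Definition word_eval Z (w : word) : 'M[C]_n :=
  foldr (fun k M => Z k *m M) 1%:M w.

(* [None] when some inversion in the expression meets a singular matrix *)
Fixpoint reval (e : rexpr) Z : option 'M[C]_n :=
  match e with
  | RPoly p => Some (\sum_(m <- p) m.1 *: word_eval Z m.2)
  | RAdd e1 e2 =>
      if (reval e1 Z, reval e2 Z) is (Some M1, Some M2)
      then Some (M1 + M2) else None
  | RMul e1 e2 =>
      if (reval e1 Z, reval e2 Z) is (Some M1, Some M2)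
      then Some (M1 *m M2) else None
  | RInv e1 =>
      if reval e1 Z is Some M
      then if M \in unitmx then Some (invmx M) else None
      else None
  end.

(* [subst_value F Z U]: [U] is obtained by substituting [Z] in rational
   expressions for the entries of [F]; the rows and columns of [U] are indexed
   as in the Kronecker product [F w *t word_eval Z w]. *)
Definition subst_value q (F : mxfps q) Z (U : 'M[C]_(q * n)) : Prop :=
  forall a b : 'I_q, exists2 e : rexpr, represents e (mx_entry F a b) &
    reval e Z = Some (\matrix_(k, l) U (mxtens_index (a, k)) (mxtens_index (b, l))).

(* The commuting variables are the entries of the N matrices. *)
Definition entry_var := ('I_N * 'I_n * 'I_n)%type.
Definition entries Z (v : 'I_#|{: entry_var}|) : C :=
  let: (k, i, j) := enum_val v in Z k i j.

(* [has_value F Z V]: the matrix-valued rational function of the entries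
   obtained by substitution in [F] is P / d with d(Z) != 0, and takes the value
   [V] at [Z]. The domain is thus the full domain of holomorphy of this rational
   function, whatever expressions are used to compute it. *)
Definition has_value q (F : mxfps q) Z (V : 'M[C]_(q * n)) : Prop :=
  exists (P : 'M[{mpoly C[#|{: entry_var}|]}]_(q * n))
         (d : {mpoly C[#|{: entry_var}|]}),
    [/\ forall W U, subst_value F W U ->
          map_mx (meval (entries W)) P = d.@[entries W] *: U,
        d.@[entries Z] != 0
      & map_mx (meval (entries Z)) P = d.@[entries Z] *: V].

End Evaluation.

(* i H^{n x n}, componentwise *)
Definition skew_tuple n (Z : 'I_N -> 'M[C]_n) : Prop :=
  forall k, exists2 X : 'M[C]_n, hermitian_mx X & Z k = 'i *: X.

Definition matrix_J_unitary q (J : 'M[C]_q) (F : mxfps q) : Prop :=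
  forall n : nat, (0 < n)%N ->
  forall Z : 'I_N -> 'M[C]_n, skew_tuple Z ->
  forall V : 'M[C]_(q * n), has_value F Z V ->
    V *m (J *t (1%:M : 'M[C]_n)) *m V ^t* = J *t (1%:M : 'M[C]_n).

End Series.
End Defs.

(* Main.v *)
Require Import Defs.
From mathcomp Require Import all_boot all_order all_algebra.
From mathcomp Require Import reals complex mxtens mpoly boolp ring zify.
Set Implicit Arguments. Unset Strict Implicit. Unset Printing Implicit Defensive.
Import Order.TTheory GRing.Theory Num.Theory.
Local Open Scope ring_scope.
Local Open Scope sesquilinear_scope.

(* Write Delta(Z) for the block diagonal pencil of Z, with Delta(Z)^* = - Delta(Z)
   on skew tuples.

   If H solves (b), then H (x) 1 commutes with Delta(Z), and the equations (b')
   turn F(Z) (J (x) 1) F(Z)^* - J (x) 1 into a multiple of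
   H^-1 Delta(Z) - Delta(Z) H^-1 = 0. Points where the realization has a pole but
   F has a value are reached along the real line t Z, on which both sides are
   polynomials in t.

   Conversely, expand F(tZ) (J (x) 1) F(tZ)^* = J (x) 1 in powers of t. Evaluated
   at skew tuples built from the letters of a word w, the coefficients give the
   identity F J F' = J of formal power series, where F' has the realization with
   matrices - A^*, C^*, - B^* and D^*, which is minimal since al is. As
   F' = J F^-1 J it is also realized by the node of the inverse, with the same
   state dimensions. The block diagonal similarity T between these two minimal realizations is unique,
   hence Hermitian, and H = - T. *)

(** * Conjugate transposes, and polynomial identities tested at natural numbers *)

Section ConjTranspose.
Variable C : numClosedFieldType.

Lemma trmxC_mul m n p (X : 'M[C]_(m, n)) (Y : 'M_(n, p)) :
  (X *m Y) ^t* = Y ^t* *m X ^t*.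
Proof. by rewrite trmx_mul map_mxM. Qed.

Lemma trmxC_D m n (X Y : 'M[C]_(m, n)) : (X + Y) ^t* = X ^t* + Y ^t*.
Proof. by rewrite linearD map_mxD. Qed.

Lemma trmxC_N m n (X : 'M[C]_(m, n)) : (- X) ^t* = - X ^t*.
Proof. by rewrite linearN map_mxN. Qed.

Lemma trmxC_Z m n (a : C) (X : 'M[C]_(m, n)) : (a *: X) ^t* = a^* *: X ^t*.
Proof. by rewrite linearZ map_mxZ. Qed.

Lemma trmxC_tens m n p q (X : 'M[C]_(m, n)) (Y : 'M[C]_(p, q)) :
  (X *t Y) ^t* = X ^t* *t Y ^t*.
Proof. by rewrite trmx_tens map_mxT. Qed.

Lemma trmxC_1 n : (1%:M : 'M[C]_n) ^t* = 1%:M.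
Proof. by rewrite trmx1 map_mx1. Qed.

End ConjTranspose.

Section PolyNat.
Variable C : numClosedFieldType.
Implicit Type p : {poly C}.

(** A nonzero polynomial has finitely many roots. Natural numbers serve as sample points because
    they are real: scaling a skew tuple by them keeps it skew. *)
Lemma poly_nat_eq0 p : (forall n : nat, p.[n%:R : C] = 0) -> p = 0.
Proof.
move=> p0; apply/eqP; apply/idPn => pN0.
pose s : seq C := [seq i%:R | i <- iota 0 (size p)].
have: (size s < size p)%N.
  apply: max_poly_roots => //.
    by apply/allP => _ /mapP[i _ ->]; apply/eqP; exact: p0.
  rewrite map_inj_uniq ?iota_uniq // => i j /eqP.
  by rewrite eqr_nat => /eqP.
by rewrite size_map size_iota ltnn.
Qed.

Lemma poly_nat_eq0_off p d : d != 0 ->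
  (forall n : nat, d.[n%:R : C] != 0 -> p.[n%:R : C] = 0) -> p = 0.
Proof.
move=> d0 pd; apply/eqP; have: d * p == 0.
  apply/eqP/poly_nat_eq0 => n; rewrite hornerM.
  have [->|/pd ->] := eqVneq d.[n%:R : C] 0; first by rewrite mul0r.
  by rewrite mulr0.
by rewrite mulf_eq0 (negPf d0).
Qed.

Lemma polymx_nat_eq m n (P Q : 'M[{poly C}]_(m, n)) (d : {poly C}) : d != 0 ->
  (forall k : nat, d.[k%:R : C] != 0 ->
     map_mx (horner_eval (k%:R : C)) P = map_mx (horner_eval (k%:R : C)) Q) -> P = Q.
Proof.
move=> d0 PQ; apply/matrixP => i j; apply/eqP; rewrite -subr_eq0; apply/eqP.
apply: (poly_nat_eq0_off d0) => k /PQ /matrixP /(_ i j).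
by rewrite !mxE /horner_eval hornerD hornerN => ->; rewrite subrr.
Qed.

End PolyNat.

(** * Truncated power series along a line *)

Section TruncatedEquality.
Variable C : fieldType.

(** Congruence modulo $X^m$ compares a fraction in $t$ with its expansion while every object stays a
    polynomial matrix. *)
Definition eqX m u v (A B : 'M[{poly C}]_(u, v)) :=
  exists Q, A = B + 'X^m *: Q.

Lemma eqX_refl m u v (A : 'M[{poly C}]_(u, v)) : eqX m A A.
Proof. by exists 0; rewrite scaler0 addr0. Qed.

Lemma eqX_sym m u v (A B : 'M[{poly C}]_(u, v)) : eqX m A B -> eqX m B A.
Proof. by case=> Q ->; exists (- Q); rewrite scalerN addrK. Qed.

Lemma eqX_trans m u v (A B D : 'M[{poly C}]_(u, v)) :
  eqX m A B -> eqX m B D -> eqX m A D.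
Proof. by case=> Q -> [Q' ->]; exists (Q' + Q); rewrite scalerDr addrA. Qed.

Lemma eqX_add m u v (A B A' B' : 'M[{poly C}]_(u, v)) :
  eqX m A B -> eqX m A' B' -> eqX m (A + A') (B + B').
Proof. by case=> Q -> [Q' ->]; exists (Q + Q'); rewrite scalerDr addrACA. Qed.

Lemma eqX_sum m u v (I : Type) (r : seq I) (A B : I -> 'M[{poly C}]_(u, v)) :
  (forall i, eqX m (A i) (B i)) ->
  eqX m (\sum_(i <- r) A i) (\sum_(i <- r) B i).
Proof.
by move=> AB; elim/big_ind2: _ => // [|*]; [exact: eqX_refl | exact: eqX_add].
Qed.

Lemma eqX_mul m u v w (A B : 'M[{poly C}]_(u, v)) (A' B' : 'M[{poly C}]_(v, w)) :
  eqX m A B -> eqX m A' B' -> eqX m (A *m A') (B *m B').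
Proof.
case=> Q -> [Q' ->]; exists (Q *m (B' + 'X^m *: Q') + B *m Q').
by rewrite mulmxDl mulmxDr -scalemxAr -scalemxAl -addrA -scalerDr [_ + Q *m _]addrC.
Qed.

Lemma eqX_scale m u v (a : {poly C}) (A B : 'M[{poly C}]_(u, v)) :
  eqX m A B -> eqX m (a *: A) (a *: B).
Proof.
by case=> Q ->; exists (a *: Q); rewrite scalerDr !scalerA [a * _]mulrC.
Qed.

Lemma eqX_scaleX m u v (A B : 'M[{poly C}]_(u, v)) :
  eqX m A B -> eqX m.+1 ('X *: A) ('X *: B).
Proof. by case=> Q ->; exists Q; rewrite scalerDr scalerA exprS. Qed.

Lemma eqX0 u v (A B : 'M[{poly C}]_(u, v)) : eqX 0 A B.
Proof. by exists (A - B); rewrite expr0 scale1r addrC subrK. Qed.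

Lemma eqX_coef m u v (A B : 'M[{poly C}]_(u, v)) i j l :
  eqX m A B -> (l < m)%N -> (A i j)`_l = (B i j)`_l.
Proof. by case=> Q -> lm; rewrite !mxE coefD coefXnM lm addr0. Qed.

Lemma eqX_eq u v (A B : 'M[{poly C}]_(u, v)) : (forall m, eqX m A B) -> A = B.
Proof.
move=> AB; apply/matrixP => i j; apply/polyP => l.
exact: (eqX_coef i j (AB l.+1)).
Qed.

(** A nonzero constant term makes [a] coprime to $X^m$, so if $X^m$ divides $a(A-B)$ entrywise, it
    divides $A-B$. *)
Lemma eqX_cancel m u v (a : {poly C}) (A B : 'M[{poly C}]_(u, v)) :
  a.[0] != 0 -> eqX m (a *: A) (a *: B) -> eqX m A B.
Proof.
move=> a0 [Q aAB].
have /coprimepP cop : coprimep 'X^m a.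
  rewrite coprimep_expl // -['X]subr0 coprimep_sym.
  by rewrite -[0](polyC0) coprimep_XsubC.
have dv i j : 'X^m %| A i j - B i j.
  rewrite -(@Gauss_dvdpr _ _ a); last by apply/coprimepP.
  move/matrixP/(_ i j): aAB; rewrite !mxE => aAB.
  by rewrite mulrBr aAB addrAC subrr add0r dvdp_mulr.
exists (\matrix_(i, j) ((A i j - B i j) %/ 'X^m)).
apply/matrixP => i j; rewrite !mxE mulrC divpK //.
by rewrite addrC subrK.
Qed.

End TruncatedEquality.

Section Series.
Variables (C : numClosedFieldType) (N : nat).

Local Notation "A ^P" := (map_mx (@polyC C) A) (at level 2, format "A ^P").

(* The part of degree [< m] of the power series [\sum_w 'X^|w| Z^w G_w]. *)
Fixpoint ser u v (Z : 'I_N -> 'M[C]_u) (G : word N -> 'M[C]_(u, v)) (m : nat)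
    {struct m} : 'M[{poly C}]_(u, v) :=
  if m is m'.+1 then
    (G [::])^P + 'X *: \sum_k (Z k)^P *m ser Z (fun w => G (k :: w)) m'
  else 0.

Definition conv u v s (G : word N -> 'M[C]_(u, v)) (G' : word N -> 'M[C]_(v, s))
    : word N -> 'M[C]_(u, s) :=
  fun w => \sum_(i < (size w).+1) G (take i w) *m G' (drop i w).

Lemma conv_nil u v s (G : word N -> 'M[C]_(u, v)) (G' : word N -> 'M[C]_(v, s)) :
  conv G G' [::] = G [::] *m G' [::].
Proof. by rewrite /conv /= big_ord_recl big_ord0 addr0. Qed.

Lemma conv_cons u v s (G : word N -> 'M[C]_(u, v)) (G' : word N -> 'M[C]_(v, s))
    k w :
  conv G G' (k :: w) =
  G [::] *m G' (k :: w) + conv (fun w => G (k :: w)) G' w.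
Proof. by rewrite /conv /= big_ord_recl. Qed.

Lemma conv_mull t u v s (M : 'M[C]_(t, u)) (G : word N -> 'M[C]_(u, v))
    (G' : word N -> 'M[C]_(v, s)) w :
  conv (fun w => M *m G w) G' w = M *m conv G G' w.
Proof. by rewrite /conv mulmx_sumr; apply: eq_bigr => i _; rewrite mulmxA. Qed.

Section Ser.
Variables (u : nat) (Z : 'I_N -> 'M[C]_u).

Lemma eq_ser v (G G' : word N -> 'M[C]_(u, v)) m :
  G =1 G' -> ser Z G m = ser Z G' m.
Proof.
elim: m G G' => //= m IH G G' GG'; rewrite GG'; congr (_ + _ *: _).
by apply: eq_bigr => k _; rewrite (IH _ (fun w => G' (k :: w))).
Qed.

Lemma ser0 v m : ser Z (fun=> 0 : 'M[C]_(u, v)) m = 0.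
Proof.
elim: m => //= m IH; rewrite map_mx0 add0r big1 ?scaler0 // => k _.
by rewrite IH mulmx0.
Qed.

Lemma serD v (G G' : word N -> 'M[C]_(u, v)) m :
  ser Z (fun w => G w + G' w) m = ser Z G m + ser Z G' m.
Proof.
elim: m G G' => [|m IH] G G' /=; first by rewrite addr0.
rewrite map_mxD addrACA -scalerDr -big_split /=; congr (_ + _ *: _).
by apply: eq_bigr => k _; rewrite IH mulmxDr.
Qed.

Lemma ser_sum v (I : Type) (r : seq I) (G : I -> word N -> 'M[C]_(u, v)) m :
  ser Z (fun w => \sum_(i <- r) G i w) m = \sum_(i <- r) ser Z (G i) m.
Proof.
elim: r => [|i r IH].
  by rewrite big_nil -[RHS](ser0 v m); apply: eq_ser => w; rewrite big_nil.
rewrite big_cons -IH -serD; apply: eq_ser => w; exact: big_cons.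
Qed.

Lemma ser_mulr v s (G : word N -> 'M[C]_(u, v)) (M : 'M[C]_(v, s)) m :
  ser Z (fun w => G w *m M) m = ser Z G m *m M^P.
Proof.
elim: m G => [|m IH] G /=; first by rewrite mul0mx.
rewrite mulmxDl -scalemxAl map_mxM; congr (_ + _ *: _).
by rewrite mulmx_suml; apply: eq_bigr => k _; rewrite IH mulmxA.
Qed.

Lemma ser_mull t v (Z' : 'I_N -> 'M[C]_t) (M : 'M[C]_(t, u))
    (G : word N -> 'M[C]_(u, v)) m :
  (forall k, Z' k *m M = M *m Z k) ->
  ser Z' (fun w => M *m G w) m = M^P *m ser Z G m.
Proof.
move=> ZM; elim: m G => [|m IH] G /=; first by rewrite mulmx0.
rewrite mulmxDr -scalemxAr map_mxM; congr (_ + _ *: _).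
rewrite mulmx_sumr; apply: eq_bigr => k _.
by rewrite IH !mulmxA -!map_mxM ZM.
Qed.

Lemma ser_trunc v (G : word N -> 'M[C]_(u, v)) m :
  eqX m (ser Z G m.+1) (ser Z G m).
Proof.
elim: m G => [|m IH] G; first exact: eqX0.
rewrite [ser Z G m.+1]/= [ser Z G m.+2]/=.
apply: eqX_add; first exact: eqX_refl.
apply: eqX_scaleX; apply: eqX_sum => k; apply: eqX_mul; first exact: eqX_refl.
exact: IH.
Qed.

End Ser.

(** The coefficients of [G] slide past the letters, exchanging [Z] and [Z']. Only a congruence
    holds, since a product of truncations can have terms of degree [m] and above. *)
Lemma ser_conv u v s (Z : 'I_N -> 'M[C]_u) (Z' : 'I_N -> 'M[C]_v)
    (G : word N -> 'M[C]_(u, v)) (G' : word N -> 'M[C]_(v, s)) m :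
  (forall k w, Z k *m G w = G w *m Z' k) ->
  eqX m (ser Z (conv G G') m) (ser Z G m *m ser Z' G' m).
Proof.
elim: m G => [|m IH] G ZG; first exact: eqX0.
have -> : ser Z (conv G G') m.+1 = (G [::])^P *m ser Z' G' m.+1
    + 'X *: \sum_k (Z k)^P *m ser Z (conv (fun w => G (k :: w)) G') m.
  rewrite /= conv_nil mulmxDr map_mxM -addrA; congr (_ + _).
  rewrite -scalemxAr -scalerDr mulmx_sumr -big_split /=; congr (_ *: _).
  apply: eq_bigr => k _; rewrite mulmxA -map_mxM -ZG map_mxM -mulmxA -mulmxDr.
  congr (_ *m _); rewrite -(ser_mull (Z := Z') (Z' := Z)) // -serD; apply: eq_ser => w.
  exact: conv_cons.
rewrite [ser Z G m.+1]/= mulmxDl -scalemxAl mulmx_suml.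
apply: eqX_add; first exact: eqX_refl.
apply: eqX_scaleX; apply: eqX_sum => k; rewrite -mulmxA.
apply: eqX_mul; first exact: eqX_refl.
(* The factor $X$ has already gained one degree, so the second series may be cut from [m.+1] to
   [m]. *)
apply: eqX_trans (IH _ (fun j w => ZG j (k :: w))) _.
by apply: eqX_mul; [exact: eqX_refl | exact/eqX_sym/ser_trunc].
Qed.

End Series.

(** * Rational expressions along a line through the origin *)

Section LineEvaluation.
Variables (C : numClosedFieldType) (N n : nat) (W : 'I_N -> 'M[C]_n).

Local Notation "A ^P" := (map_mx (@polyC C) A) (at level 2, format "A ^P").

Lemma word_eval_scale (t : C) (v : word N) :
  word_eval (fun k => t *: W k) v = t ^+ size v *: word_eval W v.
Proof.
elim: v => [|k v IH] /=; first by rewrite expr0 scale1r.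
by rewrite IH -scalemxAl -scalemxAr scalerA exprS.
Qed.

Lemma map_horner_polyC u v (t : C) (A : 'M[C]_(u, v)) :
  map_mx (horner_eval t) A^P = A.
Proof. by apply/matrixP => i j; rewrite !mxE /horner_eval hornerC. Qed.

Lemma map_horner_scale u v (t : C) (a : {poly C}) (A : 'M[{poly C}]_(u, v)) :
  map_mx (horner_eval t) (a *: A) = a.[t] *: map_mx (horner_eval t) A.
Proof. by apply/matrixP => i j; rewrite !mxE /horner_eval hornerM. Qed.

Lemma ser_monomial (c : C) (v : word N) m :
  eqX m (ser W (fun w => (c *+ (v == w))%:M) m)
        ((c%:P * 'X^(size v)) *: (word_eval W v)^P).
Proof.
elim: m v => [|m IH] v; first exact: eqX0.
case: v => [|j v] /=.
  have -> : \sum_k (W k)^P *m ser W (fun w => (c *+ ([::] == k :: w))%:M) m = 0.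
    apply: big1 => k _; rewrite (eq_ser _ (G' := fun=> 0)) ?ser0 ?mulmx0 // => w.
    by rewrite mulr0n raddf0.
  rewrite scaler0 addr0 expr0 mulr1 mulr1n map_mx1 map_scalar_mx.
  by rewrite -scalemx1; exact: eqX_refl.
rewrite mulr0n raddf0 map_mx0 add0r (bigD1 j) //= big1 ?addr0; last first.
  move=> k kj; rewrite (eq_ser _ (G' := fun=> 0)) ?ser0 ?mulmx0 // => w.
  by rewrite eqseq_cons eq_sym (negPf kj) mulr0n raddf0.
rewrite exprS mulrCA -scalerA; apply: eqX_scaleX.
rewrite map_mxM scalemxAr; apply: eqX_mul; first exact: eqX_refl.
rewrite (eq_ser _ (G' := fun w => (c *+ (v == w))%:M)) => [|w]; first exact: IH.
by rewrite eqseq_cons eqxx.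
Qed.

(* Along the line [t *: W] an expression is a rational function [p / d] of [t]
   whose expansion at [0] is the series it represents, and its domain is
   exactly [d != 0]. *)
Lemma reval_line (e : rexpr C N) (f : fps C N) : represents e f ->
  exists (p : 'M[{poly C}]_n) (d : {poly C}),
  [/\ d.[0] != 0, forall m, eqX m p (d *: ser W (fun w => (f w)%:M) m)
    & forall t, reval e (fun k => t *: W k) =
        if d.[t] != 0 then Some (d.[t]^-1 *: map_mx (horner_eval t) p)
        else None].
Proof.
elim: e f => [p|e1 IH1 e2 IH2|e1 IH1 e2 IH2|e1 IH1] f /=.
- move=> fp; exists (\sum_(x <- p) (x.1%:P * 'X^(size x.2)) *: (word_eval W x.2)^P), 1.
  split=> [|m|t]; first by rewrite hornerC oner_eq0.
    rewrite scale1r (eq_ser _ (G' := fun w => \sum_(x <- p) (x.1 *+ (x.2 == w))%:M)).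
      by rewrite ser_sum; apply/eqX_sym/eqX_sum => x; exact: ser_monomial.
    move=> w; rewrite fp /fps_poly big_mkcond raddf_sum; apply: eq_bigr => x _.
    by case: eqP.
  rewrite hornerC oner_eq0 invr1 scale1r /= raddf_sum; congr Some.
  apply: eq_bigr => x _ /=; rewrite map_horner_scale map_horner_polyC word_eval_scale.
  by rewrite hornerM hornerC hornerXn scalerA.
- move=> [f1 [f2 [/IH1[p1 [d1 [d10 p1E r1]]] /IH2[p2 [d2 [d20 p2E r2]]] fE]]].
  exists (d2 *: p1 + d1 *: p2), (d1 * d2); split=> [|m|t].
  + by rewrite hornerM mulf_neq0.
  + rewrite (eq_ser _ (G' := fun w => (f1 w)%:M + (f2 w)%:M)); last first.
      by move=> w; rewrite fE /fps_add raddfD.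
    rewrite serD scalerDr {1}mulrC -!scalerA.
    by apply: eqX_add; apply: eqX_scale.
  + rewrite r1 r2 hornerM mulf_eq0 negb_or.
    have [//|h1] := eqVneq d1.[t] 0; have [//|h2] /= := eqVneq d2.[t] 0.
    rewrite raddfD /= !map_horner_scale scalerDr !scalerA invfM; congr (Some (_ + _)).
      by congr (_ *: _); rewrite -mulrA mulVf ?mulr1.
    by congr (_ *: _); rewrite mulrAC mulVf ?mul1r.
- move=> [f1 [f2 [/IH1[p1 [d1 [d10 p1E r1]]] /IH2[p2 [d2 [d20 p2E r2]]] fE]]].
  exists (p1 *m p2), (d1 * d2); split=> [|m|t].
  + by rewrite hornerM mulf_neq0.
  + rewrite (eq_ser _ (G' := conv (fun w => (f1 w)%:M) (fun w => (f2 w)%:M))).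
      apply: eqX_trans (eqX_mul (p1E m) (p2E m)) _.
      rewrite -scalemxAl -scalemxAr scalerA; apply: eqX_scale; apply: eqX_sym.
      by apply: ser_conv => k w; rewrite scalar_mxC.
    move=> w; rewrite fE /fps_mul raddf_sum /=; apply: eq_bigr => i _.
    by rewrite scalar_mxM.
  + rewrite r1 r2 hornerM mulf_eq0 negb_or.
    have [//|h1] := eqVneq d1.[t] 0; have [//|h2] /= := eqVneq d2.[t] 0.
    by rewrite map_mxM -scalemxAl -scalemxAr scalerA invfM.
- move=> [f1 [/IH1[p1 [d1 [d10 p1E r1]]] f10 ff1 f1f]].
  have detp1 t : (\det p1).[t] = \det (map_mx (horner_eval t) p1).
    by rewrite det_map_mx.
  (* At $t=0$ this matrix is a nonzero scalar, so $\det p_1$ does not vanish there. *)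
  have p10 : map_mx (horner_eval 0) p1 = (d1.[0] * f1 [::])%:M.
    apply/matrixP => i j; have [Q ->] := p1E 1%N.
    rewrite !mxE /horner_eval hornerD !hornerM hornerXn expr1 mul0r addr0.
    by rewrite hornerD hornerM hornerX mul0r addr0 hornerC mulrnAr.
  (* Cramer's rule: $(p_1/d_1)^{-1}=d_1\,{\rm adj}(p_1)/\det p_1$. Numerator and denominator get an
     extra factor $d_1$, which keeps points where the inner expression is undefined out of the
     domain. *)
  exists (d1 ^+ 2 *: \adj p1), (d1 * \det p1); split=> [|m|t].
  + by rewrite hornerM detp1 p10 det_scalar mulf_neq0 // expf_neq0 // mulf_neq0.
  + set S := ser W _ m.
    have SS1 : eqX m (S *m ser W (fun w => (f1 w)%:M) m) 1%:M.
      have /eqX_sym/eqX_trans : eqX m (ser W (conv (fun w => (f w)%:M)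
          (fun w => (f1 w)%:M)) m) (S *m ser W (fun w => (f1 w)%:M) m).
        by apply: ser_conv => k w; rewrite scalar_mxC.
      apply; rewrite (eq_ser _ (G' := fun w => (1 *+ ([::] == w))%:M)).
        apply: eqX_trans (ser_monomial _ _ _) _; rewrite expr0 mulr1 map_mx1.
        by rewrite scale1r; exact: eqX_refl.
      move=> w; rewrite eq_sym -[1 *+ _]/((w == [::])%:R) -[X in X%:M]ff1.
      rewrite /conv /fps_mul raddf_sum /=; apply: eq_bigr => i _.
      by rewrite scalar_mxM.
    have -> : (d1 * \det p1) *: S = d1 *: (S *m p1 *m \adj p1).
      by rewrite -scalerA -mulmxA mul_mx_adj mul_mx_scalar.
    rewrite expr2 -scalerA; apply: eqX_scale.
    have -> : d1 *: \adj p1 = (d1 *: 1%:M) *m \adj p1 by rewrite -scalemxAl mul1mx.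
    apply: eqX_mul; last exact: eqX_refl.
    apply: eqX_trans (eqX_scale d1 (eqX_sym SS1)) _; rewrite scalemxAr.
    by apply: eqX_mul; [exact: eqX_refl | exact/eqX_sym].
  + rewrite r1 hornerM mulf_eq0 negb_or detp1.
    have [//|h1] /= := eqVneq d1.[t] 0.
    rewrite unitmxE detZ unitfE mulf_eq0 expf_eq0 invr_eq0 (negPf h1) andbF /=.
    case: eqVneq => //= h2; congr Some; set M := map_mx _ p1 in h2 *.
    have hM : M \in unitmx by rewrite unitmxE unitfE.
    rewrite map_horner_scale map_mx_adj -/M horner_exp.
    have -> : \adj M = \det M *: invmx M by rewrite /invmx hM scalerA divff ?scale1r.
    rewrite invmxZ ?unitmxZ ?unitfE ?invr_eq0 // !scalerA; congr (_ *: _).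
    by field; rewrite h1 h2.
Qed.

End LineEvaluation.

(** * Transfer functions as fractions *)

Section BlockProjection.
Variables (R : comNzRingType) (N : nat) (d : 'I_N -> nat).

(** The projection $E_k$ onto the $k$-th state block. Inserted between full matrices it replaces
    block indices, so that products along words have fixed sizes. *)
Definition bproj (k : 'I_N) : 'M[R]_(\sum_k d k) :=
  \matrix_(i, j) ((i == j) && (tagnat.sig1 i == k))%:R.

Lemma bprojE k : bproj k = \mxdiag_j ((j == k)%:R%:M : 'M_(d j)).
Proof.
apply/matrixP => s t; rewrite !mxE -(can_eq tagnat.sigK) /tagnat.sig1 /tagnat.sig2.
case: (tagnat.sig s) (tagnat.sig t) => [/= i j] [/= i' j'].
case: (i =P i') => [<-|ni] in j' *; last by rewrite !mxE; case: eqVneq => // -[].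
by rewrite conform_mx_id eq_Tagged/= mxE; case: (_ == _); case: (_ == _).
Qed.

Lemma mul_bproj m n (X : 'M[R]_(m, \sum_k d k)) (Y : 'M[R]_(\sum_k d k, n)) k :
  X *m bproj k *m Y = submxrow X k *m submxcol Y k.
Proof.
rewrite bprojE -{1}[X]submxrowK mul_mxrow_mxdiag -{1}[Y]submxcolK mul_mxrow_mxcol.
rewrite (bigD1 k) //= eqxx mulmx1 big1 ?addr0 // => j /negPf ->.
by rewrite mul_mx_scalar scale0r mul0mx.
Qed.

Lemma mxdiag_comm_bproj (X : forall k, 'M[R]_(d k)) k :
  \mxdiag_k X k *m bproj k = bproj k *m \mxdiag_k X k.
Proof.
rewrite bprojE /mxdiag -!/(mxdiag _) mul_mxblock_mxdiag mul_mxdiag_mxblock.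
apply/eq_mxblockP => i j; case: eqVneq => [->|_]; last by rewrite mul0mx mulmx0.
by rewrite conform_mx_id scalar_mxC.
Qed.

End BlockProjection.

Lemma map_bproj (R R' : comNzRingType) (phi : {rmorphism R -> R'}) N
    (d : 'I_N -> nat) k : map_mx phi (bproj R d k) = bproj R' d k.
Proof. by apply/matrixP => i j; rewrite !mxE rmorph_nat. Qed.

Lemma trmxC_bproj (C : numClosedFieldType) N (d : 'I_N -> nat) k :
  (bproj C d k) ^t* = bproj C d k.
Proof.
apply/matrixP => i j; rewrite !mxE conjC_nat eq_sym.
by case: eqP => // ->.
Qed.

(* [lnum / lden] is the value at [Z] of the transfer function with its resolvent
   written by Cramer's rule. *)
Section CramerFraction.
Variables (R : comNzRingType) (N n q : nat) (d : 'I_N -> nat).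
Local Notation r := (\sum_k d k)%N.
Implicit Types (A : 'M[R]_r) (B : 'M[R]_(r, q)) (K : 'M[R]_(q, r)) (D : 'M[R]_q).
Implicit Type Z : 'I_N -> 'M[R]_n.

Definition pencil Z : 'M[R]_(r * n) := \sum_k bproj R d k *t Z k.
Definition lin A Z : 'M[R]_(r * n) := 1%:M - pencil Z *m (A *t 1%:M).
Definition lden A Z : R := \det (lin A Z).
Definition lnum A B K D Z : 'M[R]_(q * n) :=
  lden A Z *: (D *t 1%:M) +
  (K *t 1%:M) *m \adj (lin A Z) *m pencil Z *m (B *t 1%:M).

End CramerFraction.

Section CramerFractionMap.
Variables (R R' : comNzRingType) (phi : {rmorphism R -> R'}) (N n q : nat).
Variable d : 'I_N -> nat.
Local Notation r := (\sum_k d k)%N.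
Local Notation "X ^F" := (map_mx phi X) (at level 2, format "X ^F").

(** Cramer's rule uses ring operations only, so the fraction can be formed over polynomials and
    specialized later, in $t$ or in the entries of generic matrices. *)
Lemma map_pencil (Z : 'I_N -> 'M[R]_n) :
  (pencil d Z)^F = pencil d (fun k => (Z k)^F).
Proof.
by rewrite /pencil raddf_sum; apply: eq_bigr => k _ /=; rewrite map_mxT map_bproj.
Qed.

Lemma map_lin (A : 'M[R]_r) (Z : 'I_N -> 'M[R]_n) :
  (lin A Z)^F = lin A^F (fun k => (Z k)^F).
Proof. by rewrite /lin map_mxB map_mxM map_mxT !map_mx1 map_pencil. Qed.

Lemma map_lden (A : 'M[R]_r) (Z : 'I_N -> 'M[R]_n) :
  phi (lden A Z) = lden A^F (fun k => (Z k)^F).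
Proof. by rewrite /lden -map_lin det_map_mx. Qed.

Lemma map_lnum (A : 'M[R]_r) (B : 'M[R]_(r, q)) (K : 'M[R]_(q, r)) (D : 'M[R]_q)
    (Z : 'I_N -> 'M[R]_n) :
  (lnum A B K D Z)^F = lnum A^F B^F K^F D^F (fun k => (Z k)^F).
Proof.
rewrite /lnum map_mxD map_mxZ map_lden !map_mxM !map_mxT !map_mx1.
by rewrite map_mx_adj map_lin map_pencil.
Qed.

End CramerFractionMap.

Section TransferSeries.
Variables (C : numClosedFieldType) (N q : nat) (al : grnode C N q).
Local Notation d := (gr_dim al).
Local Notation A := (gr_A al).
Local Notation B := (gr_B al).
Local Notation K := (gr_C al).
Local Notation D := (gr_D al).
Local Notation E := (bproj C d).
Local Notation "X ^P" := (map_mx (@polyC C) X) (at level 2, format "X ^P").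

(** The blocks [pathAB j w] for all [j], stacked into one column. *)
Fixpoint path_mx (w : word N) : 'M[C]_(\sum_k d k, q) :=
  if w is k :: w' then A *m E k *m path_mx w' else B.

Lemma submxcol_path_mx w k : submxcol (path_mx w) k = pathAB al k w.
Proof.
elim: w k => //= j w IH k; rewrite -mulmxA -submxcol_mul mulmxA mul_bproj IH.
by congr (_ *m _); apply/matrixP => a b; rewrite !mxE.
Qed.

Lemma transfer_cons k w : transfer al (k :: w) = K *m E k *m path_mx w.
Proof. by rewrite mul_bproj submxcol_path_mx. Qed.

Section Line.
Variables (n : nat) (W : 'I_N -> 'M[C]_n).
Local Notation ampl u := (fun k => (1%:M : 'M_u) *t W k).
Local Notation "X ^t1" := (X *t (1%:M : 'M[C]_n)) (at level 2, format "X ^t1").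
Local Notation line := (fun k => 'X *: (W k)^P).

Lemma tens1_mul u v s (X : 'M[C]_(u, v)) (Y : 'M[C]_(v, s)) :
  (X *m Y)^t1 = X^t1 *m Y^t1.
Proof. by rewrite tensmx_mul mulmx1. Qed.

Lemma ampl_comm u v (X : 'M[C]_(u, v)) k : ampl u k *m X^t1 = X^t1 *m ampl v k.
Proof. by rewrite !tensmx_mul !mul1mx !mulmx1. Qed.

Lemma sum_ampl_bproj u m (X : 'M[C]_(u, \sum_k d k))
   (P : 'M[{poly C}]_((\sum_k d k) * n, m)) :
  \sum_k (ampl u k)^P *m ((X *m E k)^t1^P *m P) =
  X^t1^P *m (pencil d W)^P *m P.
Proof.
rewrite /pencil raddf_sum mulmx_sumr mulmx_suml; apply: eq_bigr => k _ /=.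
by rewrite mulmxA -!map_mxM !tensmx_mul !mulmx1 !mul1mx.
Qed.

(** Splitting off the first letter gives the resolvent equation $S=B+tA\Delta(W)S$ in truncated
    form. *)
Lemma ser_path_mx m :
  ser (ampl _) (fun w => (path_mx w)^t1) m.+1 = B^t1^P +
  'X *: (A^t1^P *m (pencil d W)^P *m ser (ampl _) (fun w => (path_mx w)^t1) m).
Proof.
rewrite /= -sum_ampl_bproj; congr (_ + _ *: _); apply: eq_bigr => k _.
congr (_ *m _); rewrite -(ser_mull (Z' := ampl _)) => [|j]; last exact: ampl_comm.
by apply: eq_ser => w; rewrite tens1_mul.
Qed.

Lemma ser_transfer m :
  ser (ampl _) (fun w => (transfer al w)^t1) m.+1 = D^t1^P +
  'X *: (K^t1^P *m (pencil d W)^P *m ser (ampl _) (fun w => (path_mx w)^t1) m).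
Proof.
rewrite [LHS]/= -sum_ampl_bproj; congr (_ + _ *: _); apply: eq_bigr => k _.
congr (_ *m _); rewrite -(ser_mull (Z' := ampl _)) => [|j]; last exact: ampl_comm.
by apply: eq_ser => w; rewrite [X in X *t _]transfer_cons tens1_mul.
Qed.

Definition num_line := lnum A^P B^P K^P D^P line.
Definition den_line := lden A^P line.

Lemma num_lineE t : map_mx (horner_eval t) num_line = lnum A B K D (fun k => t *: W k).
Proof.
rewrite map_lnum !map_horner_polyC; congr lnum; apply/funext => k.
by rewrite map_horner_scale map_horner_polyC hornerX.
Qed.

Lemma den_lineE t : den_line.[t] = lden A (fun k => t *: W k).
Proof.
rewrite -[LHS]/(horner_eval t _) map_lden map_horner_polyC; congr lden.
by apply/funext => k; rewrite map_horner_scale map_horner_polyC hornerX.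
Qed.

Lemma den_line0 : den_line.[0] = 1.
Proof.
rewrite den_lineE /lden /lin.
have -> : pencil d (fun k => 0 *: W k) = 0.
  by apply: big1 => k _; rewrite scale0r tensmx0.
by rewrite mul0mx subr0 det1.
Qed.

(** With $L=I-t\Delta A$, the equation of the state series gives $L\Delta S\equiv\Delta B$;
    multiplying by the adjugate of $L$ turns $D+tK\Delta S$ into the Cramer fraction. *)
Lemma num_line_ser m :
  eqX m num_line (den_line *: ser (ampl _) (fun w => (transfer al w)^t1) m).
Proof.
case: m => [|m]; first exact: eqX0.
rewrite ser_transfer scalerDr /num_line /lnum.
have tP u v (X : 'M[C]_(u, v)) : X^P *t 1%:M = X^t1^P.
  by rewrite map_mxT map_mx1.
have pencilX : pencil d line = 'X *: (pencil d W)^P.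
  rewrite map_pencil /pencil scaler_sumr; apply: eq_bigr => k _.
  by apply/matrixP => i j; rewrite !mxE mulrCA.
rewrite !tP -/den_line; apply: eqX_add; first exact: eqX_refl.
rewrite {1}pencilX -!scalemxAr -!scalemxAl scalerA mulrC -scalerA.
apply: eqX_scaleX; rewrite -!mulmxA scalemxAr.
apply: eqX_mul; first exact: eqX_refl.
set S := ser _ _ m; set p := (pencil d W)^P; set L := lin _ _.
have -> : den_line *: (p *m S) = \adj L *m (L *m (p *m S)).
  by rewrite mulmxA mul_adj_mx mul_scalar_mx.
apply: eqX_mul; first exact: eqX_refl.
have -> : L *m (p *m S) = p *m (S - 'X *: (A^t1^P *m p *m S)).
  rewrite /L /lin tP pencilX mulmxBl mul1mx mulmxBr -!scalemxAl -scalemxAr.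
  by rewrite !mulmxA.
apply: eqX_mul; first exact: eqX_refl.
have [Q SE] := ser_trunc (ampl _) (fun w => (path_mx w)^t1) m.
by exists Q; rewrite addrAC -SE ser_path_mx addrK.
Qed.

End Line.
End TransferSeries.

(** * Values of the series and the Cramer fraction *)

Definition tensblock (T : Type) q n (U : 'M[T]_(q * n)) (a b : 'I_q) : 'M[T]_n :=
  \matrix_(k, l) U (mxtens_index (a, k)) (mxtens_index (b, l)).

Lemma tensblock_inj T q n (U V : 'M[T]_(q * n)) :
  (forall a b, tensblock U a b = tensblock V a b) -> U = V.
Proof.
move=> UV; apply/matrixP => i j.
case: (mxtens_indexP i) => a k; case: (mxtens_indexP j) => b l.
by have /matrixP/(_ k l) := UV a b; rewrite !mxE.
Qed.

Lemma map_tensblock (T T' : Type) (f : T -> T') q n (U : 'M[T]_(q * n)) a b :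
  map_mx f (tensblock U a b) = tensblock (map_mx f U) a b.
Proof. by apply/matrixP => i j; rewrite !mxE. Qed.

Lemma tensblockZ (R : pzRingType) q n x (U : 'M[R]_(q * n)) a b :
  tensblock (x *: U) a b = x *: tensblock U a b.
Proof. by apply/matrixP => i j; rewrite !mxE. Qed.

Lemma tensblock_ampl (R : comNzRingType) q n (Z : 'M[R]_n) (U : 'M[R]_(q * n)) a b :
  tensblock ((1%:M *t Z) *m U) a b = Z *m tensblock U a b.
Proof.
apply/matrixP => k l; rewrite !mxE.
under [RHS]eq_bigr do rewrite mxE.
rewrite (reindex (@mxtens_index q n)) /=; last first.
  by exists (@mxtens_unindex q n) => ? _; rewrite (mxtens_indexK, mxtens_unindexK).
pose f c m := (1%:M *t Z) (mxtens_index (a, k)) (mxtens_index (c, m)) *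
  U (mxtens_index (c, m)) (mxtens_index (b, l)).
rewrite (eq_bigr (fun p => f p.1 p.2)) => [|[] //].
rewrite -(pair_bigA _ f) /= {}/f.
rewrite (bigD1 a) //= [X in _ + X]big1 ?addr0.
  by apply: eq_bigr => m _; rewrite tensmxE mxE eqxx mul1r.
move=> c ca; apply: big1 => m _.
by rewrite tensmxE mxE eq_sym (negPf ca) !mul0r.
Qed.

Section Values.
Variables (C : numClosedFieldType) (N q : nat).

Local Notation "X ^P" := (map_mx (@polyC C) X) (at level 2, format "X ^P").

Lemma tensblock_ser n (W : 'I_N -> 'M[C]_n) (G : word N -> 'M[C]_q) m a b :
  tensblock (ser (fun k => 1%:M *t W k) (fun w => G w *t (1%:M : 'M_n)) m) a b =
  ser W (fun w => (G w a b)%:M) m.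
Proof.
elim: m G => [|m IH] G /=; first by apply/matrixP => i j; rewrite !mxE.
have tbD (X Y : 'M[{poly C}]_(q * n)) :
    tensblock (X + Y) a b = tensblock X a b + tensblock Y a b.
  by apply/matrixP => i j; rewrite !mxE.
rewrite tbD tensblockZ; congr (_ + _ *: _).
  by apply/matrixP => i j; rewrite mxE mxE tensmxE !mxE mulr_natr.
have tbS (r : seq 'I_N) (X : 'I_N -> 'M[{poly C}]_(q * n)) :
    tensblock (\sum_(k <- r) X k) a b = \sum_(k <- r) tensblock (X k) a b.
  elim: r => [|k r IHr]; last by rewrite !big_cons tbD IHr.
  by rewrite !big_nil; apply/matrixP => i j; rewrite !mxE.
rewrite tbS; apply: eq_bigr => k _.
by rewrite map_mxT map_mx1 tensblock_ampl IH.
Qed.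

Variables (F : mxfps C N q) (al : grnode C N q).
Hypothesis alF : gr_realization al F.
Local Notation A := (gr_A al).
Local Notation B := (gr_B al).
Local Notation K := (gr_C al).
Local Notation D := (gr_D al).

(** Along $tW$ the fraction $p/d$ of an expression and the Cramer fraction have the same expansion
    at $0$, hence coincide; then $t=1$. *)
Lemma subst_value_num n (W : 'I_N -> 'M[C]_n) (U : 'M[C]_(q * n)) :
  subst_value F W U -> lnum A B K D W = lden A W *: U.
Proof.
move=> FU; apply: tensblock_inj => a b; rewrite tensblockZ.
have [e eF] := FU a b; rewrite -/(tensblock U a b) => eW.
have [p [d [d0 pE re]]] := reval_line W eF.
have W1 : (fun k => 1 *: W k) = W by apply/funext => k; rewrite scale1r.
have := re 1; rewrite W1 eW; case: eqVneq => //= d1 [Ue].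
have num1 : map_mx (horner_eval 1) (num_line al W) = lnum A B K D W.
  by rewrite num_lineE W1.
have den1 : (den_line al W).[1] = lden A W by rewrite den_lineE W1.
have dE : d *: tensblock (num_line al W) a b = den_line al W *: p.
  apply: eqX_eq => m; have [Q ->] := num_line_ser al W m.
  set S := ser _ _ m.
  have -> : tensblock (den_line al W *: S + 'X^m *: Q) a b =
      den_line al W *: tensblock S a b + 'X^m *: tensblock Q a b.
    by apply/matrixP => i j; rewrite !mxE.
  apply: eqX_trans (_ : eqX m _ (d *: (den_line al W *: tensblock S a b))) _.
    by apply: eqX_scale; exists (tensblock Q a b).
  rewrite scalerA mulrC -scalerA; apply: eqX_scale; apply: eqX_sym.
  apply: eqX_trans (pE m) _; apply: eqX_scale; rewrite /S tensblock_ser.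
  rewrite (eq_ser _ (G' := fun w => (mx_entry F a b w)%:M)); first exact: eqX_refl.
  by move=> w; rewrite alF.
have := congr1 (map_mx (horner_eval 1)) dE.
rewrite !map_horner_scale map_tensblock num1 den1 Ue.
move=> /(congr1 (fun X => d.[1]^-1 *: X)).
by rewrite scalerA mulVf // scale1r => ->; rewrite !scalerA mulrC.
Qed.

Section GenericMatrices.
Variable n : nat.
Local Notation M := {mpoly C[#|{: entry_var N n}|]}.

Definition generic_tuple (k : 'I_N) : 'M[M]_n :=
  \matrix_(i, j) 'X_(enum_rank (k, i, j)).

Lemma meval_generic (Z : 'I_N -> 'M[C]_n) k :
  map_mx (meval (entries Z)) (generic_tuple k) = Z k.
Proof. by apply/matrixP => i j; rewrite !mxE mevalXU /entries enum_rankK. Qed.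

(** Over generic matrices the Cramer fraction is a quotient of polynomials in the entries, the
    witness that [has_value] asks for. *)
Lemma has_value_num (Z : 'I_N -> 'M[C]_n) (V : 'M[C]_(q * n)) :
  lden A Z != 0 -> lnum A B K D Z = lden A Z *: V -> has_value F Z V.
Proof.
pose c u v (X : 'M[C]_(u, v)) := map_mx (@mpolyC #|{: entry_var N n}| C) X.
have cK u v (X : 'M[C]_(u, v)) W : map_mx (meval (entries W)) (c _ _ X) = X.
  by apply/matrixP => i j; rewrite !mxE mevalC.
have gE (W : 'I_N -> 'M[C]_n) :
    (fun k => map_mx (meval (entries W)) (generic_tuple k)) = W.
  by apply/funext => k; exact: meval_generic.
have dE W : (lden (c _ _ A) generic_tuple).@[entries W] = lden A W.
  by rewrite map_lden cK gE.
have nE W : map_mx (meval (entries W))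
    (lnum (c _ _ A) (c _ _ B) (c _ _ K) (c _ _ D) generic_tuple) = lnum A B K D W.
  by rewrite map_lnum !cK gE.
move=> dZ nZ; exists (lnum (c _ _ A) (c _ _ B) (c _ _ K) (c _ _ D) generic_tuple).
exists (lden (c _ _ A) generic_tuple); rewrite dE nE; split=> // W U FU.
by rewrite dE nE; exact: subst_value_num.
Qed.

Lemma meval_line (Z : 'I_N -> 'M[C]_n) (p : M) :
  exists u : {poly C}, forall t, u.[t] = p.@[entries (fun k => t *: Z k)].
Proof.
exists (\sum_(m <- msupp p) (p@_m)%:P * \prod_i ((entries Z i)%:P * 'X) ^+ m i) => t.
rewrite mevalE horner_sum; apply: eq_bigr => m _.
rewrite hornerM hornerC horner_prod; congr (_ * _); apply: eq_bigr => i _.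
rewrite horner_exp hornerM hornerC hornerX mulrC; congr (_ ^+ _).
by rewrite /entries; case: (enum_val i) => [[k j] l]; rewrite mxE.
Qed.

(** The expression of each entry fails only at roots of a denominator that is nonzero at $0$. So
    substituted values exist at all but finitely many points of the line. *)
Lemma subst_value_line (Z : 'I_N -> 'M[C]_n) : mx_rational F ->
  exists2 d : {poly C}, d.[0] != 0 & forall t, d.[t] != 0 ->
    exists U, subst_value F (fun k => t *: Z k) U.
Proof.
move=> ratF.
have : forall ab : 'I_q * 'I_q, exists ed : rexpr C N * {poly C},
    [/\ ed.2.[0] != 0, represents ed.1 (mx_entry F ab.1 ab.2) & forall t,
      ed.2.[t] != 0 -> exists U, reval ed.1 (fun k => t *: Z k) = Some U].
  move=> [a b]; have [e eF] := ratF a b.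
  have [p [d [d0 _ re]]] := reval_line Z eF.
  by exists (e, d); split=> // t dt; rewrite re dt; eexists.
move=> /choice[ed edP]; exists (\prod_ab (ed ab).2).
  by rewrite horner_prod; apply/prodf_neq0 => ab _; have [] := edP ab.
move=> t; rewrite horner_prod => /prodf_neq0 dt.
have /choice[U UE] : forall ab, exists U, reval (ed ab).1 (fun k => t *: Z k) = Some U.
  by move=> ab; have [_ _ /(_ t)] := edP ab; apply; exact: dt.
exists (\matrix_(i, j) U ((mxtens_unindex i).1, (mxtens_unindex j).1)
  (mxtens_unindex i).2 (mxtens_unindex j).2) => a b.
exists (ed (a, b)).1; first by have [] := edP (a, b).
rewrite UE; congr Some; apply/matrixP => i j; rewrite !mxE.
by rewrite !mxtens_indexK.
Qed.

(** The fraction behind [has_value] agrees with the Cramer fraction at almost all natural $t$, hence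
    along the whole line. Its denominator is nonzero at $t=1$ even where that of the realization
    vanishes. *)
Lemma has_value_line (Z : 'I_N -> 'M[C]_n) (V : 'M[C]_(q * n)) :
  mx_rational F -> has_value F Z V ->
  exists (P : 'M[{poly C}]_(q * n)) (d : {poly C}),
  [/\ d.[1] != 0, map_mx (horner_eval 1) P = d.[1] *: V
    & den_line al Z *: P = d *: num_line al Z].
Proof.
move=> ratF [P [d [Pd dZ PZ]]].
have [dl dlE] := meval_line Z d.
have /choice[Pl PlE] : forall ij : 'I_(q * n) * 'I_(q * n), exists u : {poly C},
  forall t, u.[t] = (P ij.1 ij.2).@[entries (fun k => t *: Z k)].
  by move=> ij; exact: meval_line.
have Z1 : (fun k => 1 *: Z k) = Z by apply/funext => k; rewrite scale1r.
have PE t : map_mx (horner_eval t) (\matrix_(i, j) Pl (i, j)) =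
    map_mx (meval (entries (fun k => t *: Z k))) P.
  by apply/matrixP => i j; rewrite !mxE /horner_eval PlE.
exists (\matrix_(i, j) Pl (i, j)), dl; rewrite PE dlE Z1; split=> //.
have [e e0 eU] := subst_value_line Z ratF.
apply: (polymx_nat_eq (d := e)).
  by apply: contraNneq e0 => ->; rewrite horner0.
move=> k /eU[U FU]; rewrite !map_horner_scale num_lineE den_lineE PE dlE.
by rewrite (Pd _ _ FU) (subst_value_num FU) !scalerA mulrC.
Qed.

End GenericMatrices.
End Values.

(** * Sufficiency of the Lyapunov equation *)

Section JUnitaryAlgebra.
Variable C : numClosedFieldType.

Lemma trmxC_inv n (H : 'M[C]_n) : hermitian_mx H -> (invmx H) ^t* = invmx H.
Proof. by move=> HH; rewrite trmx_inv map_invmx HH. Qed.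

(** The matrix $JD^*J$ is a right inverse of the square matrix $D$, hence also a left inverse, which
    is the dual relation. *)
Lemma signature_unitary_inv q (J D : 'M[C]_q) :
  signature_mx J -> D *m J *m D ^t* = J ->
  [/\ D *m (J *m D ^t* *m J) = 1%:M, J *m D ^t* *m J *m D = 1%:M
    & D ^t* *m J *m D = J].
Proof.
move=> [_ JJ] DJ.
have D1 : D *m (J *m D ^t* *m J) = 1%:M by rewrite !mulmxA DJ JJ.
have D2 := mulmx1C D1; split=> //.
by rewrite -[LHS]mul1mx -JJ -[RHS]mulmx1 -D2 !mulmxA.
Qed.

Section Lyapunov.
Variables (r q : nat) (J D : 'M[C]_q) (A H : 'M[C]_r) (B : 'M[C]_(r, q)).
Variable K : 'M[C]_(q, r).
Hypotheses (sgJ : signature_mx J) (DJ : D *m J *m D ^t* = J).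
Hypotheses (uH : H \in unitmx) (hH : hermitian_mx H).

Let JJr m (Y : 'M_(m, q)) : Y *m J *m J = Y.
Proof. by have [_ JJ] := sgJ; rewrite -mulmxA JJ mulmx1. Qed.

Let DJr m (Y : 'M_(m, q)) : Y *m D *m J *m D ^t* = Y *m J.
Proof. by rewrite -!mulmxA (mulmxA D) DJ. Qed.

Let DJr' m (Y : 'M_(m, q)) : Y *m D ^t* *m J *m D = Y *m J.
Proof.
have [_ _ DJ'] := signature_unitary_inv sgJ DJ.
by rewrite -!mulmxA (mulmxA (D ^t*)) DJ'.
Qed.

(** Multiply the Lyapunov equation by $H^{-1}$ on both sides; inside $BJB^*$ the factor $DJD^*$
    collapses to $J$. *)
Lemma lyapunov_dual :
  A ^t* *m H + H *m A = - (K ^t* *m J *m K) ->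
  B = - (invmx H *m K ^t* *m J *m D) ->
  invmx H *m A ^t* + A *m invmx H = - (B *m J *m B ^t*) /\
  K = - (D *m J *m B ^t* *m H).
Proof.
have [Jh JJ] := sgJ; move=> lyap BE.
have BtE : B ^t* = - (D ^t* *m J *m K *m invmx H).
  by rewrite BE trmxC_N !trmxC_mul trmxCK Jh trmxC_inv // !mulmxA.
split; last first.
  rewrite BtE mulmxN mulNmx opprK -!mulmxA mulVmx // mulmx1 !mulmxA DJ JJ.
  by rewrite mul1mx.
rewrite BtE {1}BE mulNmx mulmxN mulNmx opprK !mulmxA.
rewrite DJr JJr.
have : invmx H *m (A ^t* *m H + H *m A) *m invmx H =
       invmx H *m A ^t* + A *m invmx H.
  by rewrite mulmxDr mulmxDl !mulmxA mulVmx // mul1mx -mulmxA mulmxV // mulmx1.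
by move=> <-; rewrite lyap mulmxN mulNmx !mulmxA.
Qed.

(** Multiply by $H$ on both sides; now $D^*JD=J$ collapses inside $K^*JK$. *)
Lemma lyapunov_primal :
  invmx H *m A ^t* + A *m invmx H = - (B *m J *m B ^t*) ->
  K = - (D *m J *m B ^t* *m H) ->
  A ^t* *m H + H *m A = - (K ^t* *m J *m K) /\
  B = - (invmx H *m K ^t* *m J *m D).
Proof.
have [Jh JJ] := sgJ.
move=> lyap KE.
have KtE : K ^t* = - (H *m B *m J *m D ^t*).
  by rewrite KE trmxC_N !trmxC_mul trmxCK Jh hH !mulmxA.
split; last first.
  rewrite KtE mulmxN !mulNmx opprK !mulmxA mulVmx // mul1mx.
  by rewrite DJr' JJr.
rewrite KtE {1}KE mulmxN !mulNmx opprK !mulmxA.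
have : H *m (invmx H *m A ^t* + A *m invmx H) *m H = A ^t* *m H + H *m A.
  by rewrite mulmxDr mulmxDl !mulmxA mulmxV // mul1mx mulmxKV.
move=> <-; rewrite lyap mulmxN mulNmx !mulmxA.
by rewrite DJr' JJr.
Qed.

End Lyapunov.

Section Colligation.
Variables (r q : nat) (J D : 'M[C]_q) (A P : 'M[C]_r) (B : 'M[C]_(r, q)).
Variable K : 'M[C]_(q, r).
Hypothesis skewP : P ^t* = - P.
Variable L : 'M[C]_r.
Hypotheses (LE : L = 1%:M - P *m A) (uL : L \in unitmx).
Let V := D + K *m invmx L *m P *m B.

Let LtE : L ^t* = 1%:M + A ^t* *m P.
Proof. by rewrite LE trmxC_D trmxC_1 trmxC_N trmxC_mul skewP mulmxN opprK. Qed.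

Let uLt : L ^t* \in unitmx.
Proof. by rewrite map_unitmx unitmx_tr. Qed.

Let VtE : V ^t* = D ^t* - B ^t* *m P *m invmx (L ^t*) *m K ^t*.
Proof.
rewrite /V trmxC_D !trmxC_mul skewP trmx_inv map_invmx.
by rewrite !(mulNmx, mulmxN) !mulmxA.
Qed.

(** With $R=L^{-1}$ and $Y=XA^*+AX$, expansion gives $VJV^*-J=KR\,[LXP-PXL^*+PYP]\,R^*K^*$, and the
    bracket reduces to $XP-PX=0$. It is applied to $X=H^{-1}\otimes I$ and $P=\Delta(Z)$. *)
Lemma colligation_J_unitary (X : 'M[C]_r) : X *m P = P *m X ->
  X *m A ^t* + A *m X = - (B *m J *m B ^t*) ->
  X *m K ^t* = - (B *m J *m D ^t*) -> K *m X = - (D *m J *m B ^t*) ->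
  D *m J *m D ^t* = J -> V *m J *m V ^t* = J.
Proof.
move=> XP lyap XK KX DJ; set Y := X *m A ^t* + A *m X in lyap.
have E0 : L *m X *m P - P *m X *m L ^t* + P *m Y *m P = 0.
  rewrite LtE LE /Y mulmxBl mul1mx mulmxBl mulmxDr mulmx1 mulmxDr mulmxDl !mulmxA.
  rewrite XP; apply/eqP; rewrite addr_eq0 !opprD addrACA subrr add0r.
  by rewrite [X in _ == X]addrC.
clearbody Y; pose R := invmx L; pose Rt := invmx (L ^t*).
have E : X *m P *m Rt - R *m P *m X + R *m P *m Y *m P *m Rt = 0.
  have := congr1 (fun M => R *m M *m Rt) E0; rewrite mulmx0 mul0mx => <-.
  have RL : R *m L = 1%:M by exact: mulVmx.
  have LRt : L ^t* *m Rt = 1%:M by exact: mulmxV.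
  rewrite !mulmxDr !mulmxDl !mulmxN !mulNmx !mulmxA RL mul1mx.
  by rewrite -(mulmxA _ (L ^t*)) LRt mulmx1.
rewrite VtE /V -/R -/Rt mulmxDl mulmxBr !mulmxDl !mulmxA DJ.
have -> : D *m J *m B ^t* = - (K *m X) by rewrite KX opprK.
have -> : K *m R *m P *m B *m J *m D ^t* = - (K *m (R *m P *m X) *m K ^t*).
  by rewrite !mulmxA -(mulmxA _ X) XK mulmxN opprK !mulmxA.
have -> : K *m R *m P *m B *m J *m B ^t* = - (K *m (R *m P *m Y)).
  by rewrite lyap !mulmxN opprK !mulmxA.
rewrite !mulNmx opprD !opprK -addrA -[RHS]addr0; congr (_ + _).
have := congr1 (fun M => K *m M *m K ^t*) E; rewrite mulmx0 mul0mx => <-.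
rewrite !mulmxDr !mulmxDl mulmxN mulNmx !mulmxA addrA; congr (_ + _).
exact: addrC.
Qed.

(** The push-through identity $P\,[I+A^*P]^{-1}=[I+PA^*]^{-1}P$ makes $V^*$ a transfer value again,
    for the matrices $-A^*$, $K^*$, $-B^*$, $D^*$. *)
Lemma colligation_dual : 1%:M + P *m A ^t* \in unitmx ->
  V ^t* = D ^t* - B ^t* *m invmx (1%:M + P *m A ^t*) *m P *m K ^t*.
Proof.
move=> uM; rewrite VtE -!(mulmxA (B ^t*)); congr (_ - _ *m (_ *m _)).
apply: (can_inj (mulKmx uM)); rewrite mulKVmx // mulmxA.
rewrite -[RHS](mulmxK uLt); congr (_ *m _).
by rewrite LtE mulmxDl mulmxDr mul1mx mulmx1 mulmxA.
Qed.
End Colligation.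
End JUnitaryAlgebra.

Section Skew.
Variables (C : numClosedFieldType) (N n : nat).
Local Notation "X ^P" := (map_mx (@polyC C) X) (at level 2, format "X ^P").

Lemma skew_tupleP (Z : 'I_N -> 'M[C]_n) :
  skew_tuple Z <-> (forall k, (Z k) ^t* = - Z k).
Proof.
split=> [skZ k|skZ k].
  by have [X hX ->] := skZ k; rewrite trmxC_Z conjCi hX scaleNr.
exists (- 'i *: Z k); last by rewrite scalerA mulrN -expr2 sqrCi opprK scale1r.
by rewrite /hermitian_mx trmxC_Z skZ rmorphN /= conjCi opprK scalerN scaleNr.
Qed.

Lemma skew_tuple_nat (Z : 'I_N -> 'M[C]_n) (m : nat) :
  skew_tuple Z -> skew_tuple (fun k => (m%:R : C) *: Z k).
Proof.
move=> /skew_tupleP skZ; apply/skew_tupleP => k.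
by rewrite trmxC_Z conjC_nat skZ scalerN.
Qed.

Lemma skew_pencil (d : 'I_N -> nat) (Z : 'I_N -> 'M[C]_n) :
  skew_tuple Z -> (pencil d Z) ^t* = - pencil d Z.
Proof.
move=> /skew_tupleP skZ; rewrite /pencil [X in map_mx _ X]raddf_sum raddf_sum.
rewrite -sumrN; apply: eq_bigr => k _ /=.
rewrite trmxC_tens trmxC_bproj skZ.
by apply/matrixP => i j; rewrite !mxE mulrN.
Qed.

Lemma pencil_comm (d : 'I_N -> nat) (Z : 'I_N -> 'M[C]_n) (X : 'M[C]_(\sum_k d k)) :
  (forall k, X *m bproj C d k = bproj C d k *m X) ->
  (X *t 1%:M) *m pencil d Z = pencil d Z *m (X *t 1%:M).
Proof.
move=> XE; rewrite /pencil mulmx_sumr mulmx_suml; apply: eq_bigr => k _.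
by rewrite !tensmx_mul mul1mx mulmx1 XE.
Qed.

Lemma trmxC_tens1 (q r : nat) (X : 'M[C]_(q, r)) :
  (X *t (1%:M : 'M[C]_n)) ^t* = X ^t* *t 1%:M.
Proof. by rewrite trmxC_tens trmxC_1. Qed.

Lemma tens1_N (q r : nat) (X : 'M[C]_(q, r)) :
  (- X) *t (1%:M : 'M[C]_n) = - (X *t 1%:M).
Proof. by apply/matrixP => i j; rewrite !mxE mulNr. Qed.

Lemma tens1_D (q r : nat) (X Y : 'M[C]_(q, r)) :
  (X + Y) *t (1%:M : 'M[C]_n) = X *t 1%:M + Y *t 1%:M.
Proof. by apply/matrixP => i j; rewrite !mxE mulrDl. Qed.

Section CramerValue.
Variables (q : nat) (d : 'I_N -> nat).
Local Notation r := (\sum_k d k)%N.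
Variables (A : 'M[C]_r) (B : 'M[C]_(r, q)) (K : 'M[C]_(q, r)) (D : 'M[C]_q).
Variable Z : 'I_N -> 'M[C]_n.

Definition lval : 'M[C]_(q * n) := D *t 1%:M +
  (K *t 1%:M) *m invmx (lin A Z) *m pencil d Z *m (B *t 1%:M).

Lemma lin_unit : lden A Z != 0 -> lin A Z \in unitmx.
Proof. by rewrite unitmxE unitfE. Qed.

Lemma lnum_lval : lden A Z != 0 -> lnum A B K D Z = lden A Z *: lval.
Proof.
move=> dZ; rewrite /lnum /lval scalerDr; congr (_ + _).
have -> : \adj (lin A Z) = lden A Z *: invmx (lin A Z).
  by rewrite /invmx lin_unit // scalerA divff // scale1r.
by rewrite -scalemxAr -!scalemxAl.
Qed.

End CramerValue.

(** Conjugating coefficients keeps a polynomial in $t$ that equals the conjugate transpose at real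
    $t$. *)
Definition conj_polymx u v (P : 'M[{poly C}]_(u, v)) : 'M[{poly C}]_(v, u) :=
  map_mx (map_poly Num.conj) P^T.

Lemma horner_conj_nat (p : {poly C}) (m : nat) :
  (map_poly Num.conj p).[m%:R] = p.[m%:R]^*.
Proof. by rewrite -{1}(conjC_nat C m) horner_map. Qed.

Lemma conj_polymxE u v (P : 'M[{poly C}]_(u, v)) (m : nat) :
  map_mx (horner_eval (m%:R : C)) (conj_polymx P) =
  (map_mx (horner_eval m%:R) P) ^t*.
Proof. by apply/matrixP => i j; rewrite !mxE /horner_eval horner_conj_nat. Qed.

End Skew.

Section Sufficiency.
Variables (C : numClosedFieldType) (N q : nat) (J : 'M[C]_q).
Variables (F : mxfps C N q) (al : grnode C N q).
Local Notation A := (gr_A al).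
Local Notation B := (gr_B al).
Local Notation K := (gr_C al).
Local Notation D := (gr_D al).
Local Notation "X ^P" := (map_mx (@polyC C) X) (at level 2, format "X ^P").
Hypotheses (sgJ : signature_mx J) (ratF : mx_rational F).
Hypothesis alF : gr_realization al F.

Lemma lyapunov_J_unitary (Hk : forall k, 'M[C]_(gr_dim al k)) :
  let H := \mxdiag_k Hk k in
  D *m J *m D ^t* = J -> H \in unitmx -> hermitian_mx H ->
  A ^t* *m H + H *m A = - (K ^t* *m J *m K) ->
  B = - (invmx H *m K ^t* *m J *m D) ->
  matrix_J_unitary J F.
Proof.
move=> H DJ uH hH lyap BE n n0 Z skZ V FV.
have [Jh JJ] := sgJ.
have [lyapX KE] := lyapunov_dual sgJ DJ uH hH lyap BE.
have KX : K *m invmx H = - (D *m J *m B ^t*) by rewrite KE mulNmx mulmxK.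
have XK : invmx H *m K ^t* = - (B *m J *m D ^t*).
  by rewrite -(trmxC_inv hH) -trmxC_mul KX trmxC_N !trmxC_mul trmxCK Jh mulmxA.
(* $H$ is block diagonal, so $H^{-1}$ commutes with each $E_k$. *)
have XE k : invmx H *m bproj C (gr_dim al) k = bproj C (gr_dim al) k *m invmx H.
  apply: (can_inj (mulKmx uH)); rewrite mulKVmx // mulmxA.
  by rewrite mxdiag_comm_bproj mulmxK.
have unit_lval Z' : skew_tuple Z' -> lden A Z' != 0 ->
    lval A B K D Z' *m (J *t 1%:M) *m (lval A B K D Z') ^t* = J *t (1%:M : 'M[C]_n).
  move=> skZ' dZ'.
  apply: (colligation_J_unitary (skew_pencil _ skZ') (erefl _) (lin_unit dZ')
    (pencil_comm _ XE)); rewrite !trmxC_tens1 -!tens1_mul -?tens1_D -?tens1_N.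
  - by rewrite lyapX.
  - by rewrite XK.
  - by rewrite KX.
  - by rewrite DJ.
have [P [d [d1 P1 PE]]] := has_value_line alF ratF FV.
(* The identity holds at natural $t$ off the poles of the realization, hence for all $t$; at $t=1$
   one may divide because $d(1)\neq0$. *)
have key : P *m (J *t 1%:M)^P *m conj_polymx P =
    (d * map_poly Num.conj d) *: (J *t 1%:M)^P.
  apply: (polymx_nat_eq (d := den_line al Z)) => [|k dk].
    by apply: contra_eq_neq (den_line0 al Z) => ->; rewrite horner0 eq_sym oner_eq0.
  rewrite !map_mxM conj_polymxE map_horner_scale !map_horner_polyC hornerM.
  rewrite horner_conj_nat.
  have := congr1 (map_mx (horner_eval (k%:R : C))) PE.
  rewrite !map_horner_scale num_lineE; rewrite den_lineE in dk *.
  rewrite lnum_lval //; set l := lden _ _ in dk *.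
  move=> /(congr1 (fun M => l^-1 *: M)).
  rewrite !scalerA mulVf // scale1r mulrAC mulVf // mul1r => ->.
  rewrite trmxC_Z -!scalemxAl -scalemxAr scalerA unit_lval //.
  exact: (skew_tuple_nat k skZ).
have := congr1 (map_mx (horner_eval ((1%N)%:R : C))) key.
rewrite !map_mxM conj_polymxE map_horner_scale !map_horner_polyC hornerM.
rewrite horner_conj_nat P1 trmxC_Z -!scalemxAl -scalemxAr scalerA.
move=> /(congr1 (fun M => (d.[1] * d.[1]^*)^-1 *: M)).
by rewrite !scalerA mulVf ?scale1r // mulf_neq0 // conjC_eq0.
Qed.

End Sufficiency.

(** * The power series identity *)

Section WordTuple.
Variables (C : numClosedFieldType) (N : nat) (w : word N).
Local Notation n := (size w).+1.

(* The only product of length [size w] of these matrices with a nonzero entry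
   [(0, size w)] is the one along [w]: each factor moves by one step, so all the
   steps must go up. *)
Definition word_tuple (k : 'I_N) : 'M[C]_n :=
  \matrix_(i, j) (((j == i.+1 :> nat) && (onth w i == Some k))%:R -
                  ((i == j.+1 :> nat) && (onth w j == Some k))%:R).

Lemma skew_word_tuple : skew_tuple word_tuple.
Proof.
apply/skew_tupleP => k; apply/matrixP => i j.
by rewrite !mxE rmorphB /= !conjC_nat opprB.
Qed.

(** The inequality $i+l\le j$ is the induction invariant: after a step down the remaining letters
    cannot reach column $j$, and a step up from $i$ needs the letter of [w] at position $i$. *)
Lemma coef_ser_word_tuple (f : word N -> C) m l (i j : 'I_n) :
  (l < m)%N -> (i + l <= j)%N ->
  (ser word_tuple (fun v => (f v)%:M) m i j)`_l =
  if (i + l == j)%N then f (take l (drop i w)) else 0.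
Proof.
elim: m l f i => // m IH [|l] f i lm ilj.
  rewrite /= !mxE coefD coefXM addr0 coefC /= addn0 take0.
  by rewrite -val_eqE; case: eqP.
rewrite /= !mxE coefD coefXM coefC /= add0r.
have -> : (\sum_k (map_mx polyC (word_tuple k) *m
    ser word_tuple (fun v => (f (k :: v))%:M) m)) i j =
  \sum_k \sum_c (word_tuple k i c)%:P * ser word_tuple (fun v => (f (k :: v))%:M) m c j.
  rewrite summxE; apply: eq_bigr => k _; rewrite mxE; apply: eq_bigr => c _.
  by rewrite mxE.
have iw : (i < size w)%N by have := ltn_ord j; lia.
have i1 : (i.+1 < n)%N by [].
pose k0 := tnth (in_tuple w) (Ordinal iw).
have ow : onth w i = Some k0.
  by rewrite /k0 (tnth_nth k0) onthE (nth_map k0).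
have dw : drop i w = k0 :: drop i.+1 w.
  by rewrite (drop_nth k0) //; congr (_ :: _); rewrite [RHS](tnth_nth k0).
have term k (c : 'I_n) : (word_tuple k i c)%:P *
    ser word_tuple (fun v => (f (k :: v))%:M) m c j =
    if (c == Ordinal i1) && (k == k0)
    then ser word_tuple (fun v => (f (k :: v))%:M) m c j else
    (- ((i == c.+1 :> nat) && (onth w c == Some k))%:R)%:P *
      ser word_tuple (fun v => (f (k :: v))%:M) m c j.
  rewrite mxE ow -val_eqE /= [Some _ == _]eq_sym (inj_eq Some_inj).
  have [->|_] /= := eqVneq (c : nat) i.+1; last by rewrite sub0r.
  have -> : (i == i.+2 :> nat) = false by lia.
  case: eqP => _ /=; last by rewrite sub0r.
  by rewrite subr0 mul1r.
rewrite coef_sum (bigD1 k0) //= coef_sum (bigD1 (Ordinal i1)) //=.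
rewrite term !eqxx /= IH //=; last by lia.
rewrite addSnnS dw /= big1 ?addr0 => [|c cN].
  rewrite big1 ?addr0 // => k kN; rewrite coef_sum big1 // => c _.
  rewrite term (negPf kN) andbF coefCM.
  have [ic|_] /= := eqVneq (i : nat) c.+1; last by rewrite oppr0 mul0r.
  have cl : (c + l == j)%N = false by clear -ic ilj; lia.
  by rewrite IH ?cl ?mulr0 //; clear -ic ilj; lia.
rewrite term (negPf cN) coefCM /=.
have [ic|_] /= := eqVneq (i : nat) c.+1; last by rewrite oppr0 mul0r.
have cl : (c + l == j)%N = false by clear -ic ilj; lia.
by rewrite IH ?cl ?mulr0 //; clear -ic ilj; lia.
Qed.

End WordTuple.

Section StarDual.
Variables (C : numClosedFieldType) (N q : nat).

(** For $s=-1$ the values on skew tuples are the conjugate transposes $F(Z)^*$; for $s=1$ this is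
    the adjoint node, exchanging controllability and observability. *)
Definition sdual (s : C) (al : grnode C N q) : grnode C N q :=
  @GRNode C N q (gr_dim al) (s *: (gr_A al) ^t*) ((gr_C al) ^t*)
    (s *: (gr_B al) ^t*) ((gr_D al) ^t*).

End StarDual.

Section Convolution.
Variables (C : numClosedFieldType) (N q : nat) (J : 'M[C]_q).
Variables (F : mxfps C N q) (al : grnode C N q).
Hypothesis alF : gr_realization al F.
Local Notation A := (gr_A al).
Local Notation B := (gr_B al).
Local Notation K := (gr_C al).
Local Notation D := (gr_D al).
Local Notation al' := (sdual (-1) al).
Local Notation "X ^P" := (map_mx (@polyC C) X) (at level 2, format "X ^P").

Lemma lval_sdual n (Z : 'I_N -> 'M[C]_n) : skew_tuple Z ->
  lden A Z != 0 -> lden (gr_A al') Z != 0 ->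
  lval (gr_A al') (gr_B al') (gr_C al') (gr_D al') Z = (lval A B K D Z) ^t*.
Proof.
move=> skZ dZ dZ'; have linE : lin (gr_A al') Z =
    1%:M + pencil (gr_dim al) Z *m (A *t 1%:M) ^t*.
  by rewrite /lin /= scaleN1r tens1_N mulmxN opprK trmxC_tens1.
rewrite (colligation_dual _ _ _ (skew_pencil _ skZ) (erefl (lin A Z)) (lin_unit dZ)).
  rewrite !trmxC_tens1 /lval linE /= scaleN1r tens1_N !mulNmx.
  by rewrite trmxC_tens1.
by rewrite -linE; exact: lin_unit dZ'.
Qed.

(** At natural $t$ off the poles the two fractions are $F(tZ)$ and its conjugate transpose; clearing
    denominators gives an identity of polynomials. *)
Lemma num_line_J_unitary n (Z : 'I_N -> 'M[C]_n) : (0 < n)%N ->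
  matrix_J_unitary J F -> skew_tuple Z ->
  num_line al Z *m (J *t 1%:M)^P *m num_line al' Z =
  (den_line al Z * den_line al' Z) *: (J *t 1%:M)^P.
Proof.
move=> n0 FJ skZ; apply: (polymx_nat_eq (d := den_line al Z * den_line al' Z)).
  have: (den_line al Z * den_line al' Z).[0] = 1 by rewrite hornerM !den_line0 mulr1.
  by apply: contra_eq_neq => ->; rewrite horner0 eq_sym oner_eq0.
move=> k; rewrite hornerM mulf_eq0 negb_or !den_lineE => /andP[dk dk'].
rewrite !map_mxM map_horner_scale map_horner_polyC !num_lineE hornerM !den_lineE.
rewrite !lnum_lval // -!scalemxAl -scalemxAr scalerA; congr (_ *: _).
have skk := skew_tuple_nat k skZ; rewrite lval_sdual //.
apply: (FJ n n0 _ skk); apply: (has_value_num alF dk).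
exact: lnum_lval.
Qed.

(** At the tuple built from [w], the entry from first to last index in degree $|w|$ is the
    coefficient at [w]. *)
Lemma conv_J_unitary (w : word N) : matrix_J_unitary J F ->
  conv (fun v => F v *m J) (transfer al') w = if w is [::] then J else 0.
Proof.
move=> FJ; set Kw := conv _ _; pose n := (size w).+1; pose Z := @word_tuple C N w.
have skZ : skew_tuple Z := skew_word_tuple _ _.
have key : eqX n (ser (fun k => 1%:M *t Z k) (fun v => Kw v *t 1%:M) n) (J *t 1%:M)^P.
  rewrite (eq_ser _ (G' := conv (fun v => (F v *m J) *t 1%:M)
    (fun v => transfer al' v *t 1%:M))); last first.
    move=> v; rewrite /Kw /conv; elim/big_rec2: _ => [|i X Y _ <-].
      by rewrite tens0mx.
    by rewrite tens1_D tens1_mul.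
  apply: eqX_trans.
    apply: (ser_conv (Z' := fun k => 1%:M *t Z k)) => k v; exact: ampl_comm.
  rewrite (eq_ser _ (G' := fun v => (transfer al v *t 1%:M) *m (J *t 1%:M))).
    rewrite ser_mulr.
    (* Both denominators equal $1$ at $t=0$, so they cancel modulo $X^n$. *)
    apply: (@eqX_cancel _ _ _ _ (den_line al Z * den_line al' Z)).
      by rewrite hornerM !den_line0 mulr1 oner_eq0.
    rewrite -num_line_J_unitary // scalemxAr mulrC -!scalerA.
    apply: eqX_sym; apply: eqX_trans.
      apply: eqX_mul (num_line_ser al' Z n).
      exact: eqX_mul (num_line_ser al Z n) (eqX_refl _ _).
    by rewrite -!scalemxAl -!scalemxAr scalerA mulrC -scalerA; exact: eqX_refl.
  by move=> v; rewrite alF tens1_mul.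
apply/matrixP => a b.
have /eqX_coef : eqX n (ser Z (fun v => (Kw v a b)%:M) n) ((J a b)%:M)^P.
  case: key => Q keyE; exists (tensblock Q a b); rewrite -tensblock_ser keyE.
  by apply/matrixP => i j; rewrite mxE mxE mxE tensmxE !mxE mulr_natr.
move=> /(_ ord0 ord_max (size w) (ltnSn _)).
rewrite coef_ser_word_tuple //= add0n eqxx drop0 take_size => ->.
rewrite !mxE coefC; case: w @n Z skZ key => [|k v] //=.
by rewrite mxE.
Qed.

End Convolution.

(** * Minimal realizations *)

(** As long as some [P j] escapes the current span, adding it raises the rank, which is at most
    [r]. *)
Lemma span_finite (F : fieldType) p r (P : nat -> 'M[F]_(p, r)) :
  exists m, forall j, (P j <= \sum_(i < m) <<P i>>)%MS.
Proof.
pose Q m := (\sum_(i < m) <<P i>>)%MS.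
have PQ j m : (j < m)%N -> (P j <= Q m)%MS.
  by move=> jm; apply: (sumsmx_sup (Ordinal jm)); rewrite ?genmxE.
have QQ m m' : (m <= m')%N -> (Q m <= Q m')%MS.
  move=> mm'; apply/sumsmx_subP => i _; rewrite genmxE; apply: PQ.
  exact: leq_trans mm'.
suff H k : (exists m, forall j, (P j <= Q m)%MS) \/ exists m, (k <= \rank (Q m))%N.
  by have [//|[m]] := H r.+1; rewrite ltnNge rank_leq_row.
elim: k => [|k [|[m km]]]; [by right; exists 0 | by left |].
have [?|/existsNP[j /negP PjN]] := pselect (forall j, (P j <= Q m)%MS).
  by left; exists m.
right; exists (maxn m j.+1); apply: leq_ltn_trans km _.
rewrite ltn_neqAle mxrankS ?QQ ?leq_maxl // andbT.
apply: contra PjN => rk; apply: submx_trans (PQ j _ (leq_maxr m j.+1)) _.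
by rewrite -(geq_leqif (mxrank_leqif_sup (QQ _ _ (leq_maxl m j.+1)))) (eqP rk).
Qed.

Section Controllability.
Variables (C : numClosedFieldType) (N q : nat).
Implicit Types (F : mxfps C N q) (al : grnode C N q).

(* Compressing every state block to the span of its reachable vectors does not
   change the transfer function, so minimality forces that span to be everything. *)
Lemma minimal_controllable F al : minimal_gr_realization al F ->
  forall k, exists (m : nat) (v : 'I_m -> word N)
    (u : 'I_m -> 'M[C]_(q, gr_dim al k)),
  \sum_i pathAB al k (v i) *m u i = 1%:M.
Proof.
move=> [alF min] k0.
(* Words are enumerated by their codes; numbers coding nothing give the empty word, a repetition
   harmless to spans. *)
pose wd (j : nat) : word N := odflt [::] (unpickle j).
have wdK w : exists j, wd j = w by exists (pickle w); rewrite /wd pickleK.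
pose P k j := (pathAB al k (wd j))^T.
have /choice[m mP] : forall k, exists m, forall j,
    (P k j <= \sum_(i < m) <<P k i>>)%MS by move=> k; exact: span_finite.
pose Q k := (\sum_(i < m k) <<P k i>>)%MS.
pose rb k := row_base (Q k).
(* Coordinates in the chosen basis of the span of reachable vectors. *)
pose pr k := (pinvmx (rb k))^T.
have inj_pr k w : (rb k)^T *m (pr k *m pathAB al k w) = pathAB al k w.
  apply: trmx_inj; rewrite !trmx_mul !trmxK mulmxKpV //.
  by have [j <-] := wdK w; rewrite eq_row_base; exact: mP.
pose be := @GRNode C N q (fun k => \rank (Q k))
  (\mxblock_(i, j) (pr i *m blockA al i j *m (rb j)^T))
  (\mxcol_i (pr i *m blockB al i)) (\mxrow_j (blockC al j *m (rb j)^T)) (gr_D al).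
have path_be k w : pathAB be k w = pr k *m pathAB al k w.
  elim: w k => [|j w IH] k /=; first by rewrite /blockB mxcolK.
  by rewrite IH {1}/blockA mxblockK -!mulmxA inj_pr.
have beF : gr_realization be F.
  move=> [|k w]; rewrite -alF //= path_be /blockC mxrowK -mulmxA inj_pr.
  by rewrite /blockC.
(* The compressed node has $k$-th dimension $\mathrm{rank}\,Q_k$, which minimality bounds below by
   that of [al]. *)
have full : row_full (Q k0).
  by rewrite /row_full eqn_leq rank_leq_col (min be beF k0).
have /sub_sumsmxP[u uE] : (1%:M <= Q k0)%MS by rewrite sub1mx.
have /choice[g gE] : forall i : 'I_(m k0), exists g, <<P k0 i>>%MS = g *m P k0 i.
  by move=> i; apply/submxP; rewrite genmxE.
exists (m k0), (fun i => wd i), (fun i => (u i *m g i)^T).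
apply: trmx_inj; rewrite trmx1 [RHS]uE raddf_sum; apply: eq_bigr => i _ /=.
by rewrite trmx_mul trmxK gE mulmxA.
Qed.

(** The identity of each block is a combination of reachable vectors, so a matrix is determined by
    its action on them. *)
Lemma controllable_inj F al p (Y Y' : 'M[C]_(p, \sum_k gr_dim al k)) :
  minimal_gr_realization al F ->
  (forall k w, Y *m bproj C _ k *m path_mx al w =
               Y' *m bproj C _ k *m path_mx al w) -> Y = Y'.
Proof.
move=> min YY'; apply/mxrowP => k.
have [m [v [u uE]]] := minimal_controllable min k.
rewrite -[LHS]mulmx1 -[RHS]mulmx1 -uE !mulmx_sumr; apply: eq_bigr => i _.
by rewrite !mulmxA -submxcol_path_mx -!mul_bproj YY'.
Qed.

End Controllability.

Section Observability.
Variables (C : numClosedFieldType) (N q : nat).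
Implicit Types (F : mxfps C N q) (al : grnode C N q).

(** The word is read backwards, so that conjugate transposition gives the recursion of [path_mx] for
    the dual node. *)
Fixpoint obs_mx al (w : word N) : 'M[C]_(q, \sum_k gr_dim al k) :=
  if w is k :: w' then obs_mx al w' *m bproj C _ k *m gr_A al else gr_C al.

Lemma transfer_cat al u k w :
  transfer al (rev u ++ k :: w) = obs_mx al u *m bproj C _ k *m path_mx al w.
Proof.
elim: u k w => [|j u IH] k w; first by rewrite transfer_cons.
by rewrite rev_cons cat_rcons IH /= !mulmxA.
Qed.

Variable s : C.
Hypotheses (ss : s * s = 1) (s_real : s^* = s).

Lemma path_mx_sdual al w :
  path_mx (sdual s al) w = s ^+ size w *: (obs_mx al w) ^t*.
Proof.
elim: w => [|k w IH] /=; first by rewrite scale1r.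
rewrite IH -scalemxAr -!scalemxAl scalerA -exprSr !trmxC_mul trmxC_bproj.
by rewrite mulmxA.
Qed.

Lemma transfer_sdual al w :
  transfer (sdual s al) w = s ^+ size w *: (transfer al (rev w)) ^t*.
Proof.
case: w => [|k w]; first by rewrite scale1r.
rewrite transfer_cons rev_cons -cats1 transfer_cat /= path_mx_sdual.
rewrite -scalemxAr -!scalemxAl scalerA -exprSr !trmxC_mul trmxC_bproj.
by rewrite mulmxA.
Qed.

(** For real $s$ with $s^2=1$ dualization is an involution on series and keeps dimensions, so the
    dual of a competitor [be] competes with [al]. *)
Lemma minimal_sdual al F : minimal_gr_realization al F ->
  minimal_gr_realization (sdual s al) (transfer (sdual s al)).
Proof.
move=> [alF min]; split=> // be beF k; apply: (min (sdual s be)) => w.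
rewrite transfer_sdual beF transfer_sdual revK -alF trmxC_Z trmxCK size_rev.
by rewrite scalerA rmorphXn /= s_real -exprMn ss expr1n scale1r.
Qed.

End Observability.

Section Similarity.
Variables (C : numClosedFieldType) (N q : nat).

(** Conjugate transposition reduces this to controllability of the dual node with $s=1$. *)
Lemma observable_inj (F : mxfps C N q) al p (Y Y' : 'M[C]_(\sum_k gr_dim al k, p)) :
  minimal_gr_realization al F ->
  (forall k w, obs_mx al w *m bproj C _ k *m Y =
               obs_mx al w *m bproj C _ k *m Y') -> Y = Y'.
Proof.
move=> min YY'; rewrite -[Y]trmxCK -[Y']trmxCK; congr (_ ^t*).
apply: (controllable_inj (minimal_sdual (mulr1 1) (conjC1 C) min)) => k w.
rewrite path_mx_sdual expr1n scale1r.
by have /(congr1 (fun X => X ^t*)) := YY' k w; rewrite !trmxC_mul trmxC_bproj !mulmxA.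
Qed.

Variables (d : 'I_N -> nat) (F : mxfps C N q).
Variables (A1 A2 : 'M[C]_(\sum_k d k)) (B1 B2 : 'M[C]_(\sum_k d k, q)).
Variables (K1 K2 : 'M[C]_(q, \sum_k d k)) (D1 D2 : 'M[C]_q).
Let al1 := @GRNode C N q d A1 B1 K1 D1.
Let al2 := @GRNode C N q d A2 B2 K2 D2.
Hypotheses (min1 : minimal_gr_realization al1 F).
Hypotheses (min2 : minimal_gr_realization al2 F).

(** For each letter $k$ both nodes factor the same Hankel matrix through their $k$-th state blocks.
    [T] is built to match the observability factors; their injectivity makes it match reachable
    vectors too. *)
Lemma minimal_intertwiner : exists Tk : forall k, 'M[C]_(d k),
  let T := \mxdiag_k Tk k in
  [/\ T *m B1 = B2, T *m A1 = A2 *m T, K2 *m T = K1 &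
      forall w, T *m path_mx al1 w = path_mx al2 w].
Proof.
have cat12 u k w : obs_mx al1 u *m bproj C _ k *m path_mx al1 w =
    obs_mx al2 u *m bproj C _ k *m path_mx al2 w.
  by rewrite -!transfer_cat min1.1 min2.1.
have ctrl (k : 'I_N) : exists T : 'M[C]_(d k), forall u,
    submxrow (obs_mx al2 u) k *m T = submxrow (obs_mx al1 u) k.
  have [m [v [x xE]]] := minimal_controllable min1 k.
  (* The combination giving the identity from reachable vectors of [al1] is formed with those of
     [al2]. *)
  exists (\sum_i pathAB al2 k (v i) *m x i) => u.
  rewrite -[RHS]mulmx1 -xE !mulmx_sumr; apply: eq_bigr => i _.
  by rewrite !mulmxA -!submxcol_path_mx -!mul_bproj cat12.
pose Tk k := projT1 (cid (ctrl k)).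
have TkE k u : submxrow (obs_mx al2 u) k *m Tk k = submxrow (obs_mx al1 u) k.
  exact: projT2 (cid (ctrl k)) u.
exists Tk => T.
have obsT u : obs_mx al2 u *m T = obs_mx al1 u.
  apply/mxrowP => k; rewrite -[obs_mx al2 u]submxrowK mul_mxrow_mxdiag.
  by rewrite mxrowK TkE.
have TE k : T *m bproj C d k = bproj C d k *m T by exact: mxdiag_comm_bproj.
have pathT w : T *m path_mx al1 w = path_mx al2 w.
  apply: (observable_inj min2) => k u.
  by rewrite -cat12 -obsT -!mulmxA [T *m _ in RHS]mulmxA TE !mulmxA.
split=> //; first exact: (pathT [::]); last exact: (obsT [::]).
apply: (controllable_inj min1) => k w.
have /= := pathT (k :: w); rewrite -pathT !mulmxA => ->.
by rewrite -(mulmxA A2 T) TE !mulmxA.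
Qed.

End Similarity.

(** * Necessity of the Lyapunov equation *)

(** Induction on the length of [w]: in the coefficient at [w] all terms but $G_\emptyset X_w$
    involve shorter words, and $G_\emptyset$ has a left inverse. *)
Lemma conv_inj (C : numClosedFieldType) N u v s (G : word N -> 'M[C]_(u, v))
    (X Y : word N -> 'M[C]_(v, s)) (L : 'M[C]_(v, u)) :
  L *m G [::] = 1%:M -> conv G X =1 conv G Y -> X =1 Y.
Proof.
move=> LG XY w; have [n] := ubnP (size w); elim: n w => // n IH w wn.
have := XY w; rewrite /conv !big_ord_recl /= !take0 !drop0.
rewrite (eq_bigr (fun i : 'I_(size w) =>
  G (take (bump 0 i) w) *m Y (drop (bump 0 i) w))) => [/addIr GXY|i _].
  by rewrite -[X w]mul1mx -[Y w]mul1mx -LG -!mulmxA GXY.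
rewrite IH // size_drop /bump; have := ltn_ord i; lia.
Qed.

Section Necessity.
Variables (C : numClosedFieldType) (N q : nat) (J : 'M[C]_q).
Variables (F : mxfps C N q) (al : grnode C N q).
Local Notation d := (gr_dim al).
Local Notation A := (gr_A al).
Local Notation B := (gr_B al).
Local Notation K := (gr_C al).
Local Notation D := (gr_D al).
Local Notation al' := (sdual (-1) al).
Hypotheses (sgJ : signature_mx J) (DJ : D *m J *m D ^t* = J).
Hypotheses (min : minimal_gr_realization al F) (FJ : matrix_J_unitary J F).

(* Since [D^-1 = J D^* J], this node realizes [J F^-1 J]. *)
Definition inverse_node : grnode C N q :=
  @GRNode C N q d (A - B *m J *m D ^t* *m J *m K) (B *m J *m D ^t*)
    (- (D ^t* *m J *m K)) (D ^t*).

(** In the series connection both nodes share one state: the constant term $BJ$ supplies the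
    correction $-BJD^*JK$ to $A$. *)
Lemma conv_inverse_path w :
  conv (fun v => path_mx al v *m J) (transfer inverse_node) w =
  path_mx inverse_node w.
Proof.
elim: w => [|k w IH]; first by rewrite conv_nil.
rewrite conv_cons transfer_cons /=.
have -> : conv (fun v => A *m bproj C d k *m path_mx al v *m J)
    (transfer inverse_node) w = A *m bproj C d k *m path_mx inverse_node w.
  rewrite -IH -conv_mull; congr (conv _ _ w); apply/funext => v.
  by rewrite mulmxA.
by rewrite addrC !mulmxBl !mulNmx mulmxN !mulmxA.
Qed.

Lemma conv_inverse w :
  conv (fun v => F v *m J) (transfer inverse_node) w = if w is [::] then J else 0.
Proof.
have -> : F = transfer al by apply/funext => v; rewrite min.1.
case: w => [|k w]; first by rewrite conv_nil.
rewrite conv_cons transfer_cons /=.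
have -> : conv (fun v => transfer al (k :: v) *m J) (transfer inverse_node) w =
    K *m bproj C d k *m path_mx inverse_node w.
  rewrite -conv_inverse_path -conv_mull; congr (conv _ _ w); apply/funext => v.
  by rewrite transfer_cons mulmxA.
by rewrite !mulNmx mulmxN !mulmxA DJ sgJ.2 mul1mx addNr.
Qed.

(** Both series solve $FJX=J$, and $FJ$ has the invertible constant term $DJ$. *)
Lemma transfer_inverse_node : transfer inverse_node =1 transfer al'.
Proof.
apply: (conv_inj (G := fun v => F v *m J) (L := D ^t* *m J *m J *m J)) => [|w].
  have [_ _ DJ'] := signature_unitary_inv sgJ DJ.
  by rewrite -min.1 /= mulmxA -[_ *m J *m J]mulmxA sgJ.2 mulmx1 DJ' sgJ.2.
by rewrite conv_inverse (conv_J_unitary min.1).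
Qed.

Lemma J_unitary_lyapunov : exists Hk : forall k : 'I_N, 'M[C]_(d k),
  let H := \mxdiag_k Hk k in
  [/\ H \in unitmx, hermitian_mx H, A ^t* *m H + H *m A = - (K ^t* *m J *m K)
    & B = - (invmx H *m K ^t* *m J *m D)].
Proof.
have [Jh JJ] := sgJ; have [_ _ DJ'] := signature_unitary_inv sgJ DJ.
have minD : minimal_gr_realization al' (transfer al').
  by apply: (minimal_sdual _ _ min); rewrite ?mulrNN ?mulr1 ?rmorphN1.
(* Minimality depends only on the series and the dimensions, which [inverse_node] shares with the
   dual node. *)
have minI : minimal_gr_realization inverse_node (transfer al').
  by split; [exact: transfer_inverse_node | exact: minD.2].
have [Tk [TB TA KT Tpath]] := minimal_intertwiner minI minD.
have [Sk [_ _ _ Spath]] := minimal_intertwiner minD minI.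
move: TB TA KT Tpath Spath; set T := \mxdiag_k Tk k; set S := \mxdiag_k Sk k.
move=> TB TA KT Tpath Spath.
have TE k : T *m bproj C d k = bproj C d k *m T by exact: mxdiag_comm_bproj.
have SE k : S *m bproj C d k = bproj C d k *m S by exact: mxdiag_comm_bproj.
have uT : T \in unitmx.
  (* $ST$ fixes the reachable vectors of [inverse_node]. *)
  have : S *m T = 1%:M.
    apply: (controllable_inj minI) => k w.
    by rewrite mul1mx -(mulmxA S) TE mulmxA SE -!mulmxA Tpath Spath.
  by case/mulmx1_unit.
have hT : T ^t* = T.
  (* Conjugate transposes of the relations for $T$ show that $T^*$ intertwines the same two nodes,
     so it agrees with $T$ on reachable vectors. *)
  have TtE k : T ^t* *m bproj C d k = bproj C d k *m T ^t*.
    by have /(congr1 (fun X => X ^t*)) := TE k; rewrite !trmxC_mul trmxC_bproj.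
  have TtB : T ^t* *m B = K ^t* *m J *m D.
    have /(congr1 (fun X => X ^t*)) := KT.
    rewrite /= scaleN1r mulNmx trmxC_N trmxC_N !trmxC_mul !trmxCK Jh.
    by rewrite mulmxA => /oppr_inj.
  have TtB' : T ^t* *m (B *m J *m D ^t*) = K ^t*.
    by rewrite !mulmxA TtB -!mulmxA (mulmxA D) DJ JJ mulmx1.
  have DBT : D *m J *m B ^t* *m T ^t* = K.
    have /(congr1 (fun X => X ^t*)) := TB.
    by rewrite /= !trmxC_mul !trmxCK Jh !mulmxA.
  have TtA : T ^t* *m (A - B *m J *m D ^t* *m J *m K) = - A ^t* *m T ^t*.
    have /(congr1 (fun X => X ^t*)) := TA.
    rewrite /= scaleN1r !trmxC_mul trmxC_D !trmxC_N trmxCK !trmxC_mul !trmxCK Jh.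
    rewrite mulmxBl !mulmxN => TtA.
    have {}TtA : T ^t* *m A = - A ^t* *m T ^t* + K ^t* *m J *m K.
      apply: oppr_inj; rewrite -TtA opprD mulNmx opprK; congr (_ - _).
      by rewrite -!mulmxA; congr (_ *m (_ *m _)); rewrite -[RHS]DBT !mulmxA.
    by rewrite mulmxBr TtA !mulmxA in TtB' *; rewrite TtB' addrK.
  have Ttpath w : T ^t* *m path_mx inverse_node w = path_mx al' w.
    elim: w => [|k w IH] //=.
    by rewrite -IH !mulmxA TtA scaleN1r -!mulmxA (mulmxA (T ^t*)) TtE !mulmxA.
  apply: (controllable_inj minI) => k w.
  by rewrite TtE TE -!mulmxA Ttpath Tpath.
exists (fun k => - Tk k) => H.
have HE : H = - T by rewrite /H mxdiagN.
have uH : H \in unitmx by rewrite HE -scaleN1r unitmxZ ?unitrN1.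
have TBD : T *m B = K ^t* *m J *m D.
  by rewrite /= in TB; rewrite -TB -!mulmxA (mulmxA (D ^t*)) DJ' JJ mulmx1.
have TA' : A ^t* *m T + T *m A = K ^t* *m J *m K.
  rewrite /= scaleN1r mulNmx mulmxBr !mulmxA in TA TB.
  move/eqP: TA; rewrite subr_eq TB => /eqP ->.
  by rewrite addrA subrr add0r.
split=> //.
- by rewrite /hermitian_mx HE trmxC_N hT.
- by rewrite HE mulmxN mulNmx -opprD TA'.
- by rewrite -2!mulmxA (mulmxA (K ^t*)) -mulmxN -TBD -mulNmx -HE mulKmx.
Qed.

End Necessity.

Theorem theorem4p1 (R : realType) (N q : nat) (J : 'M[R[i]]_q)
    (F : mxfps R[i] N q) (al : grnode R[i] N q) :
  signature_mx J -> mx_rational F -> minimal_gr_realization al F ->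
  let A := gr_A al in let B := gr_B al in let C := gr_C al in let D := gr_D al in
  let cond_a := D *m J *m D ^t* = J in
  let cond_b := exists Hk : forall k : 'I_N, 'M[R[i]]_(gr_dim al k),
    let H := \mxdiag_k Hk k in
    [/\ H \in unitmx, hermitian_mx H,
        A ^t* *m H + H *m A = - (C ^t* *m J *m C)
      & B = - (invmx H *m C ^t* *m J *m D)] in
  let cond_b' := exists Hk : forall k : 'I_N, 'M[R[i]]_(gr_dim al k),
    let H := \mxdiag_k Hk k in
    [/\ H \in unitmx, hermitian_mx H,
        invmx H *m A ^t* + A *m invmx H = - (B *m J *m B ^t*)
      & C = - (D *m J *m B ^t* *m H)] in
  (matrix_J_unitary J F <-> cond_a /\ cond_b) /\
  (cond_a -> (cond_b <-> cond_b')).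
Proof.
move=> sgJ ratF min A B C D cond_a cond_b cond_b'; split; [split|].
(* Condition (a) is the coefficient at the empty word of $FJF'=J$. *)
- move=> FJ; have DJ : cond_a.
    by have := conv_J_unitary min.1 [::] FJ; rewrite conv_nil -min.1.
  by split; last exact: J_unitary_lyapunov DJ min FJ.
- move=> [DJ [Hk [uH hH lyap BE]]].
  exact: (lyapunov_J_unitary sgJ ratF min.1 DJ uH hH lyap BE).
(* The same $H$ serves for (b) and (b'). *)
- move=> DJ; split=> -[Hk [uH hH lyap E]]; exists Hk.
    by have [] := lyapunov_dual sgJ DJ uH hH lyap E.
  by have [] := lyapunov_primal sgJ DJ uH hH lyap E.
Qed.
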